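(* For $n\ge 4$, let $f:S_n\to\mathbb{R}$ be a function of the form $f(\sigma)=\sum_{i,j=1}^n b_{\sigma(i)\sigma(j)}a_{ij}$ for real $n\times n$ matrices $A=(a_{ij})$, $B=(b_{ij})$, or, more generally, of the form $f(\sigma)=\sum_{i,j=1}^n c^{ij}_{\sigma(i)\sigma(j)}$ for an array $\{c^{ij}_{kl}:1\le i,j,k,l\le n\}$ of $n^4$ real numbers. Let $f_0=f-\frac1{n!}\sum_{\sigma\in S_n}f(\sigma)$ and let $\tau$ be an optimal permutation, so that $f_0(\tau)=\max_{\sigma\in S_n}f_0(\sigma)$. (1) Let us fix any $\alpha>1$. Then there exists a $\delta=\delta(\alpha)>0$ such that for all sufficiently large $n\ge N(\alpha)$ the probability that a random permutation $\sigma$ in $S_n$ satisfies the inequality $$f_0(\sigma)\ge\frac{\alpha}{n^2}f_0(\tau)$$ is at least $\delta n^{-2}$. In particular, one can choose $\delta=\exp\{-c\,\alpha\ln\alpha\}$ for some absolute constant $c>0$. (2) Let us fix any $\epsilon>0$. Then there exists a $\delta=\delta(\epsilon)<1$ such that for all sufficiently large $n\ge N(\epsilon)$ the probability that a random permutation $\sigma$ in $S_n$ satisfies the inequality $$f_0(\sigma)\ge n^{-1-\epsilon}f_0(\tau)$$ is at least $\exp\{-n^{\delta}\}$. In particular, one can choose any $\delta>1-\epsilon$.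
   Context: $S_n$ is the group of permutations of $\{1,\dots,n\}$; a random permutation is chosen uniformly from $S_n$.
   Formalization: In (2), ''any δ > 1−ε'' is read as any δ > 1−ε with δ > 0 (automatic for ε ≤ 1); for ε > 1 and δ ≤ 0 the claim is false, e.g. for f the indicator of σ(1)=1, σ(2)=2, where the probability is 1/(n(n−1)) < 1/e. *)

(* Defs.v *)
From HB Require Import structures.
From mathcomp Require Import all_boot all_order all_algebra all_fingroup.
From mathcomp Require Import all_classical all_reals all_analysis.

Set Implicit Arguments.
Unset Strict Implicit.
Unset Printing Implicit Defensive.

Import Order.TTheory GRing.Theory Num.Theory.
Local Open Scope ring_scope.

Section Defs.
Variables (R : realType) (n : nat).

(* b_{s(i) s(j)} a_{ij} *)
Definition koopmans_beckmann (A B : 'M[R]_n) (s : 'S_n) : R :=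
  \sum_(i < n) \sum_(j < n) B (s i) (s j) * A i j.

(* [c i j k l] stands for c^{ij}_{kl}. *)
Definition general_qap (c : 'I_n -> 'I_n -> 'I_n -> 'I_n -> R) (s : 'S_n) : R :=
  \sum_(i < n) \sum_(j < n) c i j (s i) (s j).

Definition qap_objective (f : 'S_n -> R) : Prop :=
  (exists A B : 'M[R]_n, forall s, f s = koopmans_beckmann A B s) \/
  (exists c : 'I_n -> 'I_n -> 'I_n -> 'I_n -> R,
     forall s, f s = general_qap c s).

Definition centered (f : 'S_n -> R) (s : 'S_n) : R :=
  f s - (n`!)%:R^-1 * \sum_(u : 'S_n) f u.

Definition optimal (f : 'S_n -> R) (tau : 'S_n) : Prop :=
  forall s : 'S_n, centered f s <= centered f tau.

Definition uniform_perm_prob (E : {set 'S_n}) : R := #|E|%:R / #|{: 'S_n}|%:R.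

End Defs.

(* Main.v *)
Require Import Defs.
From mathcomp Require Import all_boot all_order all_algebra all_fingroup.
From mathcomp Require Import zify ring lra.

(* Relabelling and rescaling, we may assume that [f] has mean 0 and that its maximum is
   attained at the identity with value 1. Averaging [f] over the permutations with
   exactly [k] fixed points and no 2-cycle gives a quadratic polynomial in [k]; its
   value at [n] is 1, while at 0 and 1 it is controlled by the L1 norm of [f], because
   these two classes have positive density. Hence the mean over the class of [k] is at
   least about [k ^ 2 / (2 n ^ 2)]. The class of [k] has density at least [1 / (5 k!)],
   so with [k] of order [n ^ (1 - eps)] this settles moderate thresholds.

   At the threshold [alpha / n ^ 2], suppose that fewer than [(1 - eps) n! / n ^ 2]
   permutations are large. Then the L1 norm of [f] is [O(1 / n ^ 2)], so that [f] is
   bounded by a small constant [kappa] outside a fraction [O(1 / n ^ 2)] of the group,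
   and second differences show that [f] is nearly constant on almost all of every
   coset [a |-> b, e |-> d]. No such constant can be much larger than [kappa], as that
   coset alone would contain [(1 - eps) (n - 2)!] large permutations; and a second
   moment computation bounds the number of cosets carrying a very negative constant.
   Second differences of [f] are therefore small except on rare configurations.
   Expanding [f] along the disjoint transpositions that undo the [k] fixed points now
   bounds the contribution of the large values to the mean over the class of [k] by a
   multiple of [k / n ^ 2], which for a large constant [k] contradicts the quadratic
   growth of the means. *)

Set Implicit Arguments.
Unset Strict Implicit.
Unset Printing Implicit Defensive.

Import Order.TTheory GRing.Theory Num.Theory.

(** * Counting permutations with prescribed values *)

Section PermCounting.
Variable T : finType.
Implicit Types (s t : seq T) (p q : {perm T}).

Lemma perm_map_seq s t : uniq s -> uniq t -> size s = size t ->
  exists p, map p s = t.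
Proof.
elim: s t => [|x s IHs] [|y t] //=; first by exists 1%g.
move=> /andP[xs us] /andP[yt ut] [/(IHs _ us ut)[p pst]].
exists (p * tperm (p x) y)%g; rewrite permM tpermL; congr (_ :: _).
rewrite -[RHS]pst; apply/eq_in_map => z zs; rewrite permM tpermD //.
  by apply: contraNneq xs => /perm_inj->.
by apply: contraNneq yt => ->; rewrite -pst map_f.
Qed.

(** Once some [p] sends [s] to [t], right multiplication by [p] carries the permutations supported
    off [s] bijectively onto those that send [s] to [t]. *)
Lemma card_perm_seq s t : uniq s -> uniq t -> size s = size t ->
  #|[set p : {perm T} | map p s == t]| = (#|T| - size s)`!.
Proof.
move=> us ut /(perm_map_seq us ut)[p pst].
have -> : #|T| - size s = #|[set x | x \notin s]|.
  have := cardC (mem s); rewrite (card_uniqP us) => <-; rewrite addKn.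
  by apply: eq_card => x; rewrite !inE.
set A := [set x | x \notin s].
rewrite -card_perm -[RHS](card_imset (perm_on A) (mulIg p)).
apply: eq_card => q; rewrite !inE; apply/eqP/imsetP.
  move=> qst; exists (q * p^-1)%g; last by rewrite mulgKV.
  rewrite unfold_in; apply/subsetP => x; rewrite !inE => qx.
  apply: contra qx => xs; rewrite permM; apply/eqP/(@perm_inj _ p).
  rewrite permKV; move: pst; rewrite -qst => /eq_in_map/(_ _ xs) //.
case=> r; rewrite unfold_in => /subsetP rs ->; rewrite -pst; apply/eq_in_map => x xs.
rewrite permM; congr (p _); apply/eqP; apply: contraT => /(rs x); rewrite !inE.
by rewrite xs.
Qed.

End PermCounting.

(** * Permutations without cycles of length at most two *)

Section ShortCycles.
Variable T : finType.
Implicit Types (A : {set T}) (p q : {perm T}) (x y z : T).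

(** The elements live in the full symmetric group and fix the complement of [A], so that different
    sets [A] are compared inside one group. *)
Definition short_free A :=
  [set p : {perm T} | perm_on A p & [forall x in A, (p x != x) && (p (p x) != x)]].

Lemma short_freeP A p :
  reflect ((forall x, x \notin A -> p x = x) /\
           (forall x, x \in A -> p x != x /\ p (p x) != x))
          (p \in short_free A).
Proof.
rewrite inE; apply: (iffP andP) => [[pA /forall_inP pN]|[pA pN]]; split=> //.
- by move=> x xA; apply: out_perm pA xA.
- by move=> x /pN/andP.
- by apply/subsetP => x; rewrite inE; apply: contraR => /pA->.
- by apply/forall_inP => x /pN[-> ->].
Qed.

Lemma card_partition_ge (aT rT : finType) (S : {set aT}) (h : aT -> rT)
    (Y : {pred rT}) d m :
  (forall w, w \in Y -> m <= d * #|[set q in S | h q == w]|) -> #|Y| * m <= d * #|S|.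
Proof.
move=> hY; rewrite -[#|S|]sum1_card (partition_big h xpredT) //= -sum_nat_const.
rewrite [X in _ <= d * X](bigID (mem Y)) /= mulnDr.
apply: leq_trans (leq_addr _ _); rewrite big_distrr /=.
apply: leq_sum => w /hY; rewrite -sum1_card; congr (_ <= _ * _).
by apply: eq_bigl => q; rewrite inE.
Qed.

(** The point [x] is inserted into a cycle of [p] immediately after [y]. That cycle had length at
    least 3, so [x] now lies on a cycle of length at least 4; the last clause separates this
    construction from the insertion of a 3-cycle. *)
Lemma insert_short_free A x y p : x \in A -> y \in A :\ x ->
    p \in short_free (A :\ x) ->
  let q : {perm T} := (tperm x y * p)%g in
  [/\ q \in short_free A, q y = x & q (q (q x)) != x].
Proof.
move=> xA /setD1P[yx yA] pS q.
have [p0 pN] := short_freeP _ _ pS.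
have px : p x = x by apply: p0; rewrite !inE eqxx.
have qx : q x = p y by rewrite permM tpermL.
have qy : q y = x by rewrite permM tpermR.
have qD z : z != x -> z != y -> q z = p z.
  by move=> zx zy; rewrite permM tpermD // eq_sym.
have pD z : z != x -> (p z != x) by rewrite -{2}px (inj_eq perm_inj).
have [pyy ppyy] : p y != y /\ p (p y) != y by apply: pN; rewrite !inE yx.
split=> //; last by rewrite qx (qD (p y)) ?pD // (qD (p (p y))) ?pD ?pD.
apply/short_freeP; split=> z.
  move=> zA; have zx : z != x by apply: contraNneq zA => ->.
  have zy : z != y by apply: contraNneq zA => ->.
  by rewrite qD // p0 // !inE (negPf zA) andbF.
move=> zA; have [->|zx] := eqVneq z x.
  by rewrite qx (qD (p y)) ?pD // pD // pD.
have [->|zy] := eqVneq z y; first by rewrite qy qx eq_sym.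
have [pz ppz] : p z != z /\ p (p z) != z by apply: pN; rewrite !inE zx.
rewrite qD //; split=> //; have [->|pzy] := eqVneq (p z) y.
  by rewrite qy eq_sym.
by rewrite qD ?pD.
Qed.

Lemma insert3_short_free A x y z p : x \in A -> y \in A -> z \in A ->
    x != y -> x != z -> y != z -> p \in short_free (A :\: [set x; y; z]) ->
  let q : {perm T} := (tperm x y * tperm x z * p)%g in
  [/\ q \in short_free A, q x = y, q y = z & q z = x].
Proof.
move=> xA yA zA xy xz yz /short_freeP[p0 pN] q.
have px : p x = x by apply: p0; rewrite !inE eqxx.
have py : p y = y by apply: p0; rewrite !inE eqxx orbT.
have pz : p z = z by apply: p0; rewrite !inE eqxx orbT.
have qx : q x = y by rewrite !permM tpermL tpermD // eq_sym.
have qy : q y = z by rewrite !permM tpermR tpermL.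
have qz : q z = x by rewrite !permM (tpermD xz yz) tpermR px.
have qD w : w != x -> w != y -> w != z -> q w = p w.
  by move=> wx wy wz; rewrite !permM !tpermD // eq_sym.
split=> //.
apply/short_freeP; split=> w.
  move=> wA; have wD u : u \in A -> w != u by move=> uA; apply: contraNneq wA => ->.
  by rewrite qD ?wD // p0 // !inE (negPf wA) andbF.
move=> wA; have [->|wx] := eqVneq w x; first by rewrite qx qy eq_sym xy eq_sym xz.
have [->|wy] := eqVneq w y; first by rewrite qy qz eq_sym yz xy.
have [->|wz] := eqVneq w z; first by rewrite qz qx xz yz.
have [pw ppw] : p w != w /\ p (p w) != w.
  by apply: pN; rewrite !inE (negPf wx) (negPf wy) (negPf wz).
rewrite qD //; split=> //; rewrite qD //.
- by rewrite -px (inj_eq perm_inj).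
- by rewrite -py (inj_eq perm_inj).
- by rewrite -pz (inj_eq perm_inj).
Qed.

(** Fix a point of [A]. The first term counts its insertions after one of the [m] other points,
    which put it on a cycle of length at least 4; the second counts the 3-cycles through it, given
    by an ordered pair of other points. *)
Lemma card_short_free_rec A d m u v : #|A| = m.+1 ->
  (forall B : {set T}, #|B| = m -> u <= d * #|short_free B|) ->
  (forall B : {set T}, #|B| = m - 2 -> v <= d * #|short_free B|) ->
  m * u + m * m.-1 * v <= d * #|short_free A|.
Proof.
move=> cA hu hv; have /card_gt0P[x xA] : 0 < #|A| by rewrite cA.
have cAx : #|A :\ x| = m by apply: succn_inj; rewrite -cA (cardsD1 x A) xA.
rewrite -(cardsID [set q : {perm T} | q (q (q x)) == x]) addnC mulnDr; apply: leq_add.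
  pose Y := [set w : T * T | [&& w.1 \in A :\ x, w.2 \in A :\ x & w.1 != w.2]].
  have -> : m * m.-1 = #|Y|.
    rewrite -sum1_card (eq_bigl (fun w : T * T => (w.1 \in A :\ x) && (w.2 \in A :\ x :\ w.1))).
      rewrite -(pair_big_dep [in A :\ x] (fun y z => z \in A :\ x :\ y) (fun _ _ => 1)) /=.
      rewrite (eq_bigr (fun=> m.-1)) ?sum_nat_const ?cAx // => y yA.
      by rewrite sum1_card; have := cardsD1 y (A :\ x); rewrite yA cAx => ->.
    by move=> [y z]; rewrite !inE /= [z == y]eq_sym; case: (y == z); rewrite ?andbF ?andbT.
  apply: (card_partition_ge (h := fun q : {perm T} => (q x, q (q x)))) => -[y z].
  rewrite !inE /= => /and3P[/andP[yx yA] /andP[zx zA] yz].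
  pose B := A :\: [set x; y; z].
  have cB : #|B| = m - 2.
    have -> : B = A :\ x :\ y :\ z.
      by apply/setP => w; rewrite !inE; case: (w == x); case: (w == y); case: (w == z).
    have := cardsD1 y (A :\ x); have := cardsD1 z (A :\ x :\ y).
    rewrite !inE zA zx [z == y]eq_sym yz yx yA cAx /= => h1 h2.
    by rewrite h2 h1 -[1 + _]/(_.+1) subn2.
  apply: leq_trans (hv _ cB) _; rewrite leq_mul2l; apply/orP; right.
  rewrite -(card_imset _ (mulgI (tperm x y * tperm x z)%g)); apply: subset_leq_card.
  apply/subsetP => _ /imsetP[p pB ->].
  have xy : x != y by rewrite eq_sym.
  have xz : x != z by rewrite eq_sym.
  have [qS qx qy qz] := insert3_short_free xA yA zA xy xz yz pB.
  by rewrite inE inE qS inE qx qy qz !eqxx.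
rewrite -[m in m * u]cAx.
apply: (card_partition_ge (h := fun q : {perm T} => (q^-1)%g x)) => y yA.
apply: leq_trans (hu _ cAx) _; rewrite leq_mul2l; apply/orP; right.
rewrite -(card_imset _ (mulgI (tperm x y)%g)); apply: subset_leq_card.
apply/subsetP => _ /imsetP[p pB ->].
have [qS qy qx] := insert_short_free xA yA pB.
move: (_ * p)%g qS qy qx => q qS qy qx.
by rewrite inE inE qS inE qx -qy permK eqxx.
Qed.

(* The proportion [u m / m`!] of permutations of [m] points without cycles of
   length at most 2 satisfies [u_m / m! = ((m-1) u_(m-1)/(m-1)! + u_(m-3)/(m-3)!) / m],
   a convex combination, so a bound valid for three consecutive sizes propagates. *)
Lemma card_short_free A : 3 <= #|A| -> #|A|`! <= 5 * #|short_free A|.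
Proof.
have [m] := ubnP #|A|; elim: m => // m IHm in A *; rewrite ltnS => cAm cA3.
have u0 (B : {set T}) : #|B| = 0 -> 5 <= 5 * #|short_free B|.
  move=> /eqP; rewrite cards_eq0 => /eqP->; rewrite leq_pmulr //.
  by apply/card_gt0P; exists 1%g; apply/short_freeP; split=> x; rewrite ?perm1 ?inE.
(* Sizes 3, 4 and 5 start the induction, with 10 >= 3!, 30 >= 4! and 120 = 5!. At size 5 only the 24
   cycles of length 5 qualify, and this equality dictates the constant 5. *)
have u3 (B : {set T}) : #|B| = 3 -> 10 <= 5 * #|short_free B|.
  by move=> cB; apply: (@card_short_free_rec B 5 2 0 5 cB).
have u4 (B : {set T}) : #|B| = 4 -> 30 <= 5 * #|short_free B|.
  by move=> cB; apply: (@card_short_free_rec B 5 3 10 0 cB).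
have u5 (B : {set T}) : #|B| = 5 -> 120 <= 5 * #|short_free B|.
  by move=> cB; apply: (@card_short_free_rec B 5 4 30 0 cB).
have [k cA] : exists k, #|A| = k.+3 by exists (#|A| - 3); lia.
case: k cA => [|[|[|k]]] cA.
- by rewrite cA; apply: leq_trans (u3 _ cA).
- by rewrite cA; apply: leq_trans (u4 _ cA).
- by rewrite cA; apply: leq_trans (u5 _ cA).
have IH (B : {set T}) : 3 <= #|B| -> #|B| < #|A| -> #|B|`! <= 5 * #|short_free B|.
  by move=> B3 BA; apply: IHm => //; lia.
have hu (B : {set T}) : #|B| = k.+4.+1 -> (k.+4.+1)`! <= 5 * #|short_free B|.
  by move=> cB; rewrite -cB; apply: IH; rewrite cB ?cA.
have hv (B : {set T}) : #|B| = k.+4.+1 - 2 -> (k.+3)`! <= 5 * #|short_free B|.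
  rewrite subSS subSS subn0 => cB; rewrite -cB; apply: IH; rewrite cB ?cA //; lia.
(* For [m = k + 5] the recurrence yields [m * m! + m * (m - 1) * (m - 2)!], which is [(m + 1)!]. *)
apply: leq_trans (card_short_free_rec cA hu hv); rewrite cA.
rewrite [in leqLHS]factS mulSn addnC leq_add2l [in leqLHS]factS -mulnA leq_mul2l /=.
by rewrite factS.
Qed.

End ShortCycles.

(** * Averages over permutations with a given number of fixed points *)

Section PermClass.
Variable T : finType.
Implicit Types p q : {perm T}.

Definition fixset p : {set T} := [set x | p x == x].

Definition perm_class k : {set {perm T}} :=
  [set p | (#|fixset p| == k) && [forall x, (p (p x) == x) ==> (p x == x)]].

Lemma perm_classP k p :
  reflect (#|fixset p| = k /\ forall x, p (p x) = x -> p x = x) (p \in perm_class k).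
Proof.
rewrite inE; apply: (iffP andP) => [[/eqP pk /forallP pN]|[pk pN]]; split=> //.
- by move=> x /eqP ppx; apply/eqP/(implyP (pN x)).
- exact/eqP.
- by apply/forallP => x; apply/implyP => /eqP/pN->.
Qed.

Lemma fixsetJ p q : fixset (p ^ q)%g = q @: fixset p.
Proof.
apply/setP => x; rewrite -(permKV q x) mem_imset ?inE; last exact: perm_inj.
by rewrite permJ (inj_eq perm_inj).
Qed.

Lemma perm_classJ k p q : ((p ^ q)%g \in perm_class k) = (p \in perm_class k).
Proof.
apply/perm_classP/perm_classP; rewrite fixsetJ card_imset; try exact: perm_inj.
  move=> [pk pN]; split=> // x ppx; apply/(@perm_inj _ q); rewrite -permJ; apply: pN.
  by rewrite !permJ ppx.
move=> [pk pN]; split=> // x; rewrite -(permKV q x) !permJ => /perm_inj/pN.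
by move=> ->.
Qed.

(** The permutations are sorted by their fixed set. Its complement has at least 3 points, the range
    in which [card_short_free] applies. *)
Lemma card_perm_class k : k + 3 <= #|T| -> #|T|`! <= 5 * k`! * #|perm_class k|.
Proof.
move=> kT; rewrite -(@bin_fact #|T| k) 1?mulnAC -1?mulnA 1?[_ * k`!]mulnC; last by lia.
rewrite mulnCA [leqRHS]mulnCA leq_mul2l; apply/orP; right.
rewrite -card_draws.
apply: (card_partition_ge (h := fixset)) => K; rewrite inE => /eqP cK.
have <- : #|~: K| = #|T| - k by rewrite cardsCs setCK cK.
apply: leq_trans (card_short_free _) _; first by rewrite cardsCs setCK cK; lia.
rewrite leq_mul2l /=; apply: subset_leq_card; apply/subsetP => p /short_freeP[p0 pN].
have fK : fixset p = K.
  apply/setP => x; rewrite inE; have [xK|xK] := boolP (x \in K).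
    by rewrite p0 ?eqxx // inE negbK.
  by have [/negPf->] := pN x (etrans (in_setC x K) xK).
rewrite inE fK eqxx andbT; apply/perm_classP; rewrite fK; split=> // x ppx.
have [xK|xK] := boolP (x \in K); first by apply: p0; rewrite inE negbK.
by have [_] := pN x (etrans (in_setC x K) xK); rewrite ppx eqxx.
Qed.

End PermClass.

Section ClassAverage.
Variables (R : realFieldType) (T : finType).
Implicit Types (c : T -> T -> T -> T -> R) (p q s : {perm T}) (f : {perm T} -> R).
Local Open Scope ring_scope.

Definition quad_sum c s : R := \sum_i \sum_j c i j (s i) (s j).

Let H c x y z w := \sum_(p : {perm T}) c (p x) (p y) (p z) (p w).

Lemma sum_conj_quad_sum c s :
  \sum_(p : {perm T}) quad_sum c (s ^ p)%g = \sum_x \sum_y H c x y (s x) (s y).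
Proof.
rewrite (eq_bigr (fun p : {perm T} =>
  \sum_x \sum_y c (p x) (p y) (p (s x)) (p (s y)))).
  rewrite exchange_big; apply: eq_bigr => x _; exact: exchange_big.
move=> p _; rewrite /quad_sum (reindex_inj (@perm_inj _ p)); apply: eq_bigr => x _.
rewrite (reindex_inj (@perm_inj _ p)); apply: eq_bigr => y _.
by rewrite !permJ.
Qed.

Lemma Hinv c q x y z w : H c (q x) (q y) (q z) (q w) = H c x y z w.
Proof.
rewrite /H (reindex_inj (mulgI q^-1%g)); apply: eq_bigr => p _.
by rewrite !permM !permK.
Qed.

(* [H c] depends only on which of its four points coincide, and as [s] has no
   2-cycle the coincidence pattern of [x, y, s x, s y] is read off from
   [s x = x], [s y = y], [s x = y] and [s y = x]. *)
Lemma sum_conj_poly c : (4 <= #|T|)%N ->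
  exists h0 h1 h2 : R, forall s, (forall x, s (s x) = x -> s x = x) ->
    \sum_(p : {perm T}) quad_sum c (s ^ p)%g =
      h0 + h1 * #|fixset s|%:R + h2 * #|fixset s|%:R ^+ 2.
Proof.
move=> T4; have [e0 [e1 [e2 [e3]]]] : exists e0 e1 e2 e3 : T, uniq [:: e0; e1; e2; e3].
  have : uniq (take 4 (enum T)) by rewrite take_uniq ?enum_uniq.
  have : size (take 4 (enum T)) = 4 by rewrite size_takel // -cardT.
  case: (take 4 _) => [|e0 [|e1 [|e2 [|e3 []]]]] //= _ ue.
  by exists e0, e1, e2, e3.
move=> ue.
have ue1 : uniq [:: e0] by [].
have ue2 : uniq [:: e0; e1] by move: ue; rewrite /= !inE; do !case: eqP => //.
have ue3 : uniq [:: e0; e1; e2] by move: ue; rewrite /= !inE; do !case: eqP => //.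
have H1 x : H c x x x x = H c e0 e0 e0 e0.
  have [q [<-]] := perm_map_seq ue1 (isT : uniq [:: x]) erefl; exact: Hinv.
have H2 x y : x != y -> [/\ H c x x y y = H c e0 e0 e1 e1
    & H c x y x y = H c e0 e1 e0 e1].
  move=> xy; have uxy : uniq [:: x; y] by rewrite /= !inE xy.
  by have [q [<- <-]] := perm_map_seq ue2 uxy erefl; rewrite !Hinv.
have H3 x y z : uniq [:: x; y; z] -> [/\ H c x y x z = H c e0 e1 e0 e2,
    H c x y z y = H c e0 e1 e2 e1, H c x y y z = H c e0 e1 e1 e2
    & H c x y z x = H c e0 e1 e2 e0].
  by move=> uxy; have [q [<- <- <-]] := perm_map_seq ue3 uxy erefl; rewrite !Hinv.
have H4 x y z w : uniq [:: x; y; z; w] -> H c x y z w = H c e0 e1 e2 e3.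
  by move=> uxy; have [q [<- <- <- <-]] := perm_map_seq ue uxy erefl; rewrite !Hinv.
move: (H c e0 e0 e0 e0) (H c e0 e0 e1 e1) (H c e0 e1 e0 e1) H1 H2 => k0 k1 k2 H1 H2.
move: (H c e0 e1 e0 e2) (H c e0 e1 e2 e1) (H c e0 e1 e1 e2) (H c e0 e1 e2 e0) H3.
move=> k3 k4 k5 k6 H3; move: (H c e0 e1 e2 e3) H4 => k7 H4.
pose N : R := #|T|%:R.
exists (N * (k1 - k7 + N * k7 + (k5 - k7) + (k6 - k7))),
  (k0 - k1 - k2 + k7 - (k5 + k6 - k7 *+ 2) + N * (k3 - k7) + N * (k4 - k7)),
  (k2 - k3 - k4 + k7).
move=> s sN; rewrite sum_conj_quad_sum.
pose u x : R := (s x == x)%:R; pose v x y : R := (s x == y)%:R.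
pose X : R := #|fixset s|%:R; rewrite -/X.
have sumu : \sum_x u x = X.
  by rewrite /X -sum1_card natr_sum [RHS]big_mkcond /=; apply: eq_bigr => x _; rewrite inE /u; case: eqP.
have sumv x : \sum_y v x y = 1.
  rewrite (bigD1 (s x)) //= /v eqxx big1 ?addr0 // => y; rewrite eq_sym.
  by move=> /negPf->.
have sumv' x : \sum_y v y x = 1.
  rewrite (bigD1 ((s^-1)%g x)) //= /v permKV eqxx big1 ?addr0 // => y.
  by rewrite (canF_eq (permK s)) => /negPf->.
(* [F] writes the off-diagonal values in terms of indicators. Its last two summands correct the
   generic value [k7] when [s x = y] or [s y = x]; off the diagonal these exclude each other, as [s]
   has no 2-cycle. *)
pose F x y := u x * u y * k2 + u x * (1 - u y) * k3 + (1 - u x) * u y * k4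
  + (1 - u x) * (1 - u y) * k7 + v x y * (k5 - k7) + v y x * (k6 - k7).
have HF x y : y != x -> H c x y (s x) (s y) = F x y.
  rewrite eq_sym => xy; rewrite /F /u /v.
  have sxy : s x != s y by rewrite (inj_eq perm_inj).
  have [sx|sx] := eqVneq (s x) x; have [sy|sy] := eqVneq (s y) y.
  - have [_ h] := H2 _ _ xy; rewrite sx sy h (negPf xy) eq_sym (negPf xy) /=; ring.
  - have yx : s y != x by rewrite -{1}sx eq_sym.
    have [|h _ _ _] := H3 x y (s y).
      by rewrite /= !inE negb_or xy eq_sym yx eq_sym sy.
    by rewrite sx h (negPf xy) (negPf yx) /=; ring.
  - have yx : s x != y by rewrite -[X in _ != X]sy.
    have [|_ h _ _] := H3 x y (s x).
      by rewrite /= !inE negb_or xy eq_sym sx eq_sym yx.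
    by rewrite sy h (negPf yx) eq_sym (negPf xy) /=; ring.
  have [sxy'|sxy'] := eqVneq (s x) y.
    have sy' : s y != x by apply: contraNneq sx => sy'; rewrite sN // sxy'.
    have [|_ _ h _] := H3 x y (s y).
      by rewrite /= !inE negb_or xy eq_sym sy' eq_sym sy.
    by rewrite (negPf sy') sxy' h /=; ring.
  have [syx|syx] := eqVneq (s y) x.
    have [|_ _ _ h] := H3 x y (s x).
      by rewrite /= !inE negb_or xy eq_sym sx eq_sym sxy'.
    by rewrite syx h /=; ring.
  rewrite H4; first by rewrite /=; ring.
  by rewrite /= !inE !negb_or xy sxy ![_ == s _]eq_sym sx sxy' syx sy.
have Hd x : H c x x (s x) (s x) = u x * k0 + (1 - u x) * k1.
  rewrite /u; have [->|sx] := eqVneq (s x) x; first by rewrite H1 /=; ring.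
  by rewrite eq_sym in sx; have [-> _] := H2 _ _ sx; rewrite /=; ring.
have FX x : F x x = u x * k2 + (1 - u x) * k7 + u x * (k5 + k6 - k7 *+ 2).
  by rewrite /F /v -/(u x) /u; case: eqP => _ /=; ring.
have sumF x : \sum_y F x y = u x * X * k2 + u x * (N - X) * k3 + (1 - u x) * X * k4
    + (1 - u x) * (N - X) * k7 + (k5 - k7) + (k6 - k7).
  have sum1u : \sum_y (1 - u y) = N - X by rewrite sumrB sumu sumr_const.
  rewrite /F !big_split /= -!mulr_suml -!mulr_sumr sumu sum1u sumv sumv'.
  by rewrite !mul1r.
(* The diagonal terms obey another rule, so [F x x] is exchanged for the true value in order to sum
   [F] over all [y]. *)
rewrite (eq_bigr (fun x => (u x * k0 + (1 - u x) * k1) - F x x + \sum_y F x y)).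
  rewrite (eq_bigr (fun x => (k1 - k7 + X * k4 + (N - X) * k7 + (k5 - k7) + (k6 - k7))
    + u x * (k0 - k1 - k2 + k7 - (k5 + k6 - k7 *+ 2)
       + X * k2 + (N - X) * k3 - X * k4 - (N - X) * k7))).
    by rewrite big_split /= -mulr_suml sumu sumr_const -mulr_natl -/N; ring.
  by move=> x _; rewrite FX sumF; ring.
move=> x _; rewrite (bigD1 x) //= Hd [in RHS](bigD1 x) //= addrA subrK.
by congr (_ + _); apply: eq_bigr => y /HF.
Qed.

(** The class of [k] is stable under conjugation, so the sum over it may first be averaged over
    conjugates. The identity is its own only conjugate and enters the same polynomial with [#|T|]
    fixed points. *)
Lemma perm_class_sum c : (4 <= #|T|)%N ->
  exists h0 h1 h2 : R,
    (forall k, \sum_(s in perm_class T k) quad_sum c s =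
       #|perm_class T k|%:R * (h0 + h1 * k%:R + h2 * k%:R ^+ 2)) /\
    quad_sum c 1%g = h0 + h1 * #|T|%:R + h2 * #|T|%:R ^+ 2.
Proof.
move=> /(sum_conj_poly c)[h0 [h1 [h2 hs]]].
have F0 : (#|{perm T}|%:R : R) != 0.
  by rewrite pnatr_eq0 -lt0n; apply/card_gt0P; exists 1%g.
pose F : R := #|{perm T}|%:R; exists (h0 / F), (h1 / F), (h2 / F); split=> [k|].
  apply: (mulIf F0); rewrite -/F.
  have -> : (\sum_(s in perm_class T k) quad_sum c s) * F =
      \sum_(p : {perm T}) \sum_(s in perm_class T k) quad_sum c (s ^ p)%g.
    rewrite /F mulrC mulr_natl -sumr_const; apply: eq_bigr => p _.
    rewrite (reindex_inj (conjg_inj p)); apply: eq_bigl => s.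
    exact: perm_classJ.
  rewrite exchange_big /= (eq_bigr (fun=> h0 + h1 * k%:R + h2 * k%:R ^+ 2)).
    by rewrite sumr_const -mulr_natl -/F; field.
  by move=> s /perm_classP[<- sN]; rewrite hs.
apply: (mulIf F0); rewrite -/F.
have fix1 : #|fixset (1%g : {perm T})| = #|T|.
  by rewrite -cardsT; congr #|pred_of_set _|; apply/setP => x; rewrite !inE perm1 eqxx.
have := hs 1%g (fun x _ => perm1 x); rewrite fix1.
rewrite (eq_bigr (fun=> quad_sum c 1%g)) => [|p _]; last by rewrite conj1g.
rewrite sumr_const -[_ *+ _]mulr_natr -[X in _ * X = _ -> _]/F => ->; by field.
Qed.

End ClassAverage.

Local Open Scope ring_scope.

(** * Second differences and concentration on cosets *)

Section SecondDifference.
Variables (R : realFieldType) (T : finType) (c : T -> T -> T -> T -> R).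
Implicit Types (p q s : {perm T}).

Definition cross (g : T -> T -> R) a a' b b' := g a b - g a b' - g a' b + g a' b'.

(** Two positions [x] and [y] meet in [quad_sum] in both orders, hence the symmetrization. *)
Definition coupling x k y l := c x y k l + c y x l k.

(** The mixed second difference of the objective along the disjoint transpositions of [a, a'] and of
    [e, e'], the values at these points being [b, b'] and [d, d']. *)
Definition second_diff a a' b b' e e' d d' :=
  cross (fun x k => cross (coupling x k) e e' d d') a a' b b'.

Lemma sum_supp2 (F : T -> R) x y : x != y ->
  (forall j, j != x -> j != y -> F j = 0) -> \sum_j F j = F x + F y.
Proof.
move=> xy F0; rewrite (bigD1 x) //= (bigD1 y) 1?eq_sym //= big1 ?addr0 //.
by move=> j /andP[/F0].
Qed.

Lemma sum_supp4 (F : T -> R) x y z w : uniq [:: x; y; z; w] ->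
  (forall j, j \notin [:: x; y; z; w] -> F j = 0) ->
  \sum_j F j = F x + F y + F z + F w.
Proof.
move=> u F0; rewrite (bigID (mem [:: x; y; z; w])) /= [X in _ + X]big1 // addr0.
by rewrite -(big_uniq _ u) /= !big_cons big_nil addr0 !addrA.
Qed.

(** A term whose two indices are both fixed by one of the transpositions cancels. There remain the
    terms with one index in [{a, a'}] and the other in [{e, e'}]. *)
Lemma second_diffE s a a' e e' : uniq [:: a; a'; e; e'] ->
  quad_sum c s - quad_sum c (tperm a a' * s)%g - quad_sum c (tperm e e' * s)%g
    + quad_sum c (tperm a a' * tperm e e' * s)%g
  = second_diff a a' (s a) (s a') e e' (s e) (s e').
Proof.
move=> u; move: (u); rewrite /= !inE !negb_or.
case/and4P=> /and3P[aa' ae ae'] /andP[a'e a'e'] ee' _.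
pose W i j := c i j (s i) (s j) - c i j (s (tperm a a' i)) (s (tperm a a' j))
  - c i j (s (tperm e e' i)) (s (tperm e e' j))
  + c i j (s (tperm e e' (tperm a a' i))) (s (tperm e e' (tperm a a' j))).
have -> : quad_sum c s - quad_sum c (tperm a a' * s)%g - quad_sum c (tperm e e' * s)%g
    + quad_sum c (tperm a a' * tperm e e' * s)%g = \sum_i \sum_j W i j.
  rewrite /quad_sum -!sumrB -big_split; apply: eq_bigr => i _.
  rewrite -!sumrB -big_split; apply: eq_bigr => j _.
  by rewrite /W !permM.
have W1 i j : tperm a a' i = i -> tperm a a' j = j -> W i j = 0.
  by move=> hi hj; rewrite /W hi hj; ring.
have W2 i j : tperm e e' i = i -> tperm e e' j = j -> W i j = 0.
  by move=> hi hj; rewrite /W; case: (tpermP a a' i) hi => [->|->|_ _] hi;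
     case: (tpermP a a' j) hj => [->|->|_ _] hj;
     rewrite ?hi ?hj ?(tpermD _ _) // 1?eq_sym //; ring.
have sj i : i \in [:: a; a'] -> \sum_j W i j = W i e + W i e'.
  move=> hi; apply: sum_supp2 => // j je je'; apply: W2; rewrite tpermD // 1?eq_sym //.
    by move: hi; rewrite !inE => /pred2P[]->.
  by move: hi; rewrite !inE => /pred2P[]->.
have sj' i : i \in [:: e; e'] -> \sum_j W i j = W i a + W i a'.
  move=> hi; apply: sum_supp2 => // j ja ja'; apply: W1; rewrite tpermD // 1?eq_sym //.
    by move: hi; rewrite !inE => /pred2P[]->; rewrite eq_sym.
  by move: hi; rewrite !inE => /pred2P[]->; rewrite eq_sym.
rewrite (sum_supp4 u); last first.
  move=> i; rewrite !inE !negb_or => /and4P[ia ia' ie ie']; apply: big1 => j _.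
  have hi1 : tperm a a' i = i by rewrite tpermD // eq_sym.
  have hi2 : tperm e e' i = i by rewrite tpermD // eq_sym.
  have [hj|hj] := boolP (j \in [:: a; a']).
    apply: W2 => //; move: hj; rewrite !inE => /pred2P[]->; rewrite tpermD // 1?eq_sym //.
  apply: W1 => //; move: hj; rewrite !inE negb_or => /andP[? ?].
  by rewrite tpermD // eq_sym.
rewrite (sj a) ?(sj a') ?(sj' e) ?(sj' e') ?inE ?eqxx ?orbT // /W /second_diff /cross /coupling.
have [ea ea' e'a e'a'] : [/\ e != a, e != a', e' != a & e' != a'].
  by split; rewrite eq_sym.
rewrite !(tpermL, tpermR, tpermD ae a'e, tpermD ae' a'e', tpermD ea e'a, tpermD ea' e'a').
by ring.
Qed.

(** Passing from couplings to differences from a base point adds only terms that omit one of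
    [x, k, y, l], and these are killed by the two crossings. The base point can therefore be chosen
    at will. *)
Lemma second_diff_ref a0 b0 e0 d0 a a' b b' e e' d d' :
  second_diff a a' b b' e e' d d' =
  cross (fun x k => cross (fun y l => second_diff x a0 k b0 y e0 l d0) e e' d d') a a' b b'.
Proof. by rewrite /second_diff /cross; ring. Qed.

End SecondDifference.

Lemma card_partition_le (aT rT : finType) (S : {set aT}) (h : aT -> rT)
    (Y : {set rT}) m :
  (forall x, x \in S -> h x \in Y) ->
  (forall w, w \in Y -> #|[set x in S | h x == w]| <= m)%N -> (#|S| <= #|Y| * m)%N.
Proof.
move=> hS hY; rewrite -[#|S|]sum1_card (partition_big h (mem Y)) //= -sum_nat_const.
apply: leq_sum => w /hY; rewrite -sum1_card; apply: leq_trans.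
by rewrite leq_eqVlt; apply/orP; left; apply/eqP/eq_bigl => q; rewrite inE.
Qed.

Lemma fact_pred2 m : (1 < m)%N -> (m`! = m * (m - 1) * (m - 2)`!)%N.
Proof. by case: m => [|[|m]] // _; rewrite !factS !subSS !subn0 mulnA. Qed.

Lemma ffact_le_exp n m : (n ^_ m <= n ^ m)%N.
Proof.
by elim: m => // m IHm; rewrite ffactnSr expnSr leq_mul // leq_subr.
Qed.

Lemma card_uniq_ext (T : finType) (s : seq T) : uniq s ->
  #|[set w : T * T | uniq (w.1 :: w.2 :: s)]| = ((#|T| - size s) * (#|T| - size s).-1)%N.
Proof.
have cC (t : seq T) : uniq t -> #|[pred x | x \notin t]| = (#|T| - size t)%N.
  move=> ut; have := cardC (mem t); rewrite (card_uniqP ut) => <-; rewrite addKn.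
  by apply: eq_card => x; rewrite !inE.
move=> us; rewrite -sum1_card.
rewrite (eq_bigl (fun w : T * T => (w.2 \notin s) && (w.1 \notin w.2 :: s))); last first.
  by move=> [x y]; rewrite inE /= us andbT andbC.
transitivity (\sum_(y | y \notin s) \sum_(x | x \notin y :: s) 1)%N.
  rewrite pair_big_dep /= [RHS](reindex (fun w : T * T => (w.2, w.1))) /=.
    by apply: eq_bigl => -[x y].
  by exists (fun w : T * T => (w.2, w.1)) => -[].
rewrite (eq_bigr (fun=> (#|T| - size s).-1)); last first.
  by move=> y ys; rewrite sum1_card cC /= ?ys // subnS.
by rewrite sum_nat_const cC.
Qed.

Section Concentration.
Variables (R : realFieldType) (T : finType) (c : T -> T -> T -> T -> R).
Variables (f : {perm T} -> R) (k0 : R).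
Hypothesis f_quad : forall s, f s = quad_sum c s + k0.
Implicit Types (p q s : {perm T}) (r : (T * T) * (T * T)).
Local Notation n := #|T|.

Lemma second_diff_perm s a a' e e' : uniq [:: a; a'; e; e'] ->
  f s - f (tperm a a' * s)%g - f (tperm e e' * s)%g + f (tperm a a' * tperm e e' * s)%g
  = second_diff c a a' (s a) (s a') e e' (s e) (s e').
Proof. by move=> /(second_diffE c s) <-; rewrite !f_quad; ring. Qed.

Definition coset2 a b e d := [set s : {perm T} | (s a == b) && (s e == d)].

(* The pair [r.1] of positions and the pair [r.2] of values serve as base points
   for the coefficient attached to the coset [a |-> b, e |-> d]. *)
Definition based_coef r a b e d :=
  second_diff c a r.1.1 b r.2.1 e r.1.2 d r.2.2.

Variable kappa : R.
Definition heavy := [set s | kappa < `|f s|].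

Section Coset.
Variables a b e d : T.
Hypotheses (ae : a != e) (bd : b != d).

Let Z := [set w : {perm T} * (T * T) | [&& w.1 \in coset2 a b e d,
  uniq [:: w.2.1; w.2.2; a; e] &
  3 * kappa < `|f w.1 - based_coef (w.2, (w.1 w.2.1, w.1 w.2.2)) a b e d|]].

(** For [s] in the coset and base positions [x, y], the gap is a signed sum of three values of [f]:
    at [s] composed with the transposition of [a, x], with that of [e, y], and with both. One of
    these permutations is heavy. Together with one of [x, y] it determines everything, the other
    position being the preimage of [b] or of [d]. *)
Let card_Z : (#|Z| <= 3 * n * #|heavy|)%N.
Proof.
pose ph1 (w : {perm T} * (T * T)) := (tperm a w.2.1 * w.1, w.2.2)%g.
pose ph2 (w : {perm T} * (T * T)) := (tperm e w.2.2 * w.1, w.2.1)%g.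
pose ph3 (w : {perm T} * (T * T)) := (tperm a w.2.1 * tperm e w.2.2 * w.1, w.2.2)%g.
pose D (ph : {perm T} * (T * T) -> {perm T} * T) := [set w in Z | (ph w).1 \in heavy].
have DE ph w : w \in Z -> (w \in D ph) = (kappa < `|f (ph w).1|).
  by move=> wZ; rewrite inE wZ inE.
have ZU : Z \subset D ph1 :|: D ph2 :|: D ph3.
  apply/subsetP => -[s [x y]] wZ; rewrite !in_setU !DE //=; move: wZ; rewrite !inE /=.
  case/and3P=> /andP[/eqP sa /eqP se] uxy; apply: contraTT.
  rewrite !negb_or -!leNgt => /andP[/andP[h1 h2] h3].
  have u : uniq [:: a; x; e; y].
    move: uxy; rewrite /= !inE !negb_or ![x == _]eq_sym ![y == _]eq_sym.
    by case/and4P=> /and3P[-> -> ->] /andP[-> ->] -> _.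
  rewrite /based_coef /= -sa -se -(second_diff_perm s u).
  rewrite (_ : _ - _ = f (tperm a x * s)%g + f (tperm e y * s)%g
    - f (tperm a x * tperm e y * s)%g); last by ring.
  rewrite (le_trans (ler_normB _ _)) // (_ : 3 * kappa = kappa + kappa + kappa); last by ring.
  by rewrite lerD // (le_trans (ler_normD _ _)) // lerD.
have inj ph : {in D ph &, injective ph} -> (#|D ph| <= #|heavy| * n)%N.
  move=> /card_in_imset <-; rewrite -cardsT -cardsX; apply: subset_leq_card.
  by apply/subsetP => _ /imsetP[w wD ->]; move: wD; rewrite !inE andbT => /andP[].
have DP ph s x y : (s, (x, y)) \in D ph ->
    [/\ s a = b, s e = d, x != e, a != x & [&& a != y, x != y & e != y]].
  rewrite inE => /andP[]; rewrite inE /= => /and3P[]; rewrite !inE !negb_or.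
  move=> /andP[/eqP-> /eqP->] /and4P[/and3P[xy xa xe] /andP[ya ye] _ _] _ _.
  by rewrite [a == x]eq_sym [a == y]eq_sym [e == y]eq_sym xa xe xy ya ye.
apply: leq_trans (subset_leq_card ZU) _; apply: leq_trans (leq_card_setU _ _) _.
apply: leq_trans (leq_add (leq_card_setU _ _) (leqnn _)) _.
rewrite (_ : 3 * n * #|heavy| = #|heavy| * n + #|heavy| * n + #|heavy| * n)%N; last by lia.
apply: leq_add; first apply: leq_add; apply: inj => -[s [x y]] [s' [x' y']].
- move=> /DP[sa se xe ax /and3P[ay xy ey]] /DP[s'a s'e x'e ax' /and3P[ay' xy' ey']] [es ->].
  have ex : x = x'.
    apply: (@perm_inj _ (tperm a x * s)%g); rewrite [in RHS]es !permM !tpermR.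
    by rewrite sa s'a.
  by move: es; rewrite ex => /mulgI->.
- move=> /DP[sa se xe ax /and3P[ay xy ey]] /DP[s'a s'e x'e ax' /and3P[ay' xy' ey']] [es ->].
  have ex : y = y'.
    apply: (@perm_inj _ (tperm e y * s)%g); rewrite [in RHS]es !permM !tpermR.
    by rewrite se s'e.
  by move: es; rewrite ex => /mulgI->.
move=> /DP[sa se xe ax /and3P[ay xy ey]] /DP[s'a s'e x'e ax' /and3P[ay' xy' ey']] [es eyy].
have ex : x = x'.
  apply: (@perm_inj _ (tperm a x * tperm e y * s)%g); rewrite [in RHS]es !permM !tpermR.
  by rewrite !tpermD 1?eq_sym // sa s'a.
by move: es; rewrite ex eyy => /mulgI->.
Qed.

Let good r1 := [set r2 : (T * T) * (T * T) |
  uniq [:: r2.1.1; r2.1.2; r1.1.1; r1.1.2; a; e] &&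
  uniq [:: r2.2.1; r2.2.2; r1.2.1; r1.2.2; b; d]].

Let J := [set w : ((T * T) * (T * T)) * ((T * T) * (T * T)) |
  (w.2 \in good w.1) && (6 * kappa < `|based_coef w.2 a b e d - based_coef w.1 a b e d|)].

(** A pair in [J] is realized by [(n - 6)!] permutations of the coset, each of which misses its
    based coefficient by more than [3 kappa] at one of the two base points. The positions of the
    other one account for [n ^ 2]. *)
Let card_J : ((n - 6)`! * #|J| <= 2 * n ^ 2 * #|Z|)%N.
Proof.
pose bases (u : {perm T} * ((T * T) * (T * T))) := ((u.2.1, (u.1 u.2.1.1, u.1 u.2.1.2)),
  (u.2.2, (u.1 u.2.2.1, u.1 u.2.2.2))).
pose V := [set u | (u.1 \in coset2 a b e d) && (bases u \in J)].
have JV : (#|J| * (n - 6)`! <= 1 * #|V|)%N.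
  apply: (card_partition_ge (h := bases)) => -[[[x1 y1] [z1 w1]] [[x2 y2] [z2 w2]]] wJ.
  have /andP[ur uc] : uniq [:: x2; y2; x1; y1; a; e] && uniq [:: z2; w2; z1; w1; b; d].
    by move: wJ; rewrite in_set => /andP[]; rewrite in_set.
  rewrite mul1n -(card_perm_seq ur uc) //.
  rewrite -(card_imset (f := fun s => (s, ((x1, y1), (x2, y2))))); last by move=> s s' [].
  apply: subset_leq_card; apply/subsetP => _ /imsetP[s + ->]; rewrite inE => /eqP[].
  move=> sx2 sy2 sx1 sy1 sa se.
  have bE : bases (s, ((x1, y1), (x2, y2))) = (((x1, y1), (z1, w1)), ((x2, y2), (z2, w2))).
    by rewrite /bases /= sx1 sy1 sx2 sy2.
  by rewrite in_set bE eqxx andbT in_set bE wJ andbT in_set /= sa se !eqxx.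
rewrite mulnC; apply: leq_trans JV _; rewrite mul1n.
pose Vi (ph : (T * T) * (T * T) -> (T * T) * (T * T)) :=
  [set u : {perm T} * ((T * T) * (T * T)) | (u.1, (ph u.2).1) \in Z].
have cVi ph : injective ph -> (#|Vi ph| <= n ^ 2 * #|Z|)%N.
  move=> inj_ph; pose h (u : {perm T} * ((T * T) * (T * T))) := ((u.1, (ph u.2).1), (ph u.2).2).
  rewrite mulnC -mulnn -card_prod -cardsT -cardsX -(card_imset (f := h)); last first.
    move=> [s u] [s' u'] [-> e1 e2]; congr (_, _); apply: inj_ph.
    by case: (ph u) (ph u') e1 e2 => [? ?] [? ?] /= -> ->.
  by apply: subset_leq_card; apply/subsetP => _ /imsetP[u + ->]; rewrite !inE andbT.
have VU : V \subset Vi id :|: Vi (fun w => (w.2, w.1)).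
  apply/subsetP => -[s [[x1 y1] [x2 y2]]].
  rewrite in_set => /andP[sc]; rewrite in_set => /andP[sg hk].
  have /andP[ur _] : uniq [:: x2; y2; x1; y1; a; e] && uniq [:: s x2; s y2; s x1; s y1; b; d].
    by move: sg; rewrite in_set.
  have ZE w : uniq [:: w.1; w.2; a; e] -> ((s, w) \in Z) =
      (3 * kappa < `|f s - based_coef (w, (s w.1, s w.2)) a b e d|).
    by move=> u; rewrite in_set u sc.
  move: hk; apply: contraTT; rewrite in_setU negb_or ![_ \in Vi _]in_set.
  have u1 : uniq [:: x1; y1; a; e].
    by move: ur; rewrite -[uniq _]/(uniq ([:: x2; y2] ++ [:: x1; y1; a; e])) cat_uniq => /and3P[].
  have u2 : uniq [:: x2; y2; a; e].
    apply: subseq_uniq ur; rewrite -[[:: x2; y2; a; e]]/([:: x2; y2] ++ [:: a; e]).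
    by rewrite -[[:: x2; _; _; _; _; _]]/([:: x2; y2] ++ [:: x1; y1; a; e]) cat_subseq // -[in X in subseq _ X]/([:: x1; y1] ++ [:: a; e]) suffix_subseq.
  rewrite !ZE // -!leNgt => /andP[h1 h2].
  rewrite /= (_ : _ - _ = (f s - based_coef (x1, y1, (s x1, s y1)) a b e d)
    - (f s - based_coef (x2, y2, (s x2, s y2)) a b e d)); last by ring.
  rewrite (le_trans (ler_normB _ _)) // (_ : 6 * kappa = 3 * kappa + 3 * kappa); last by ring.
  exact: lerD.
apply: leq_trans (subset_leq_card VU) _; apply: leq_trans (leq_card_setU _ _) _.
rewrite -mulnA mul2n -addnn; apply: leq_add; apply: cVi => //.
by move=> [w w'] [v v'] [-> ->].
Qed.

Definition off_base m := [set r | 6 * kappa < `|based_coef r a b e d - m|].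
Definition off_value m := [set s in coset2 a b e d | 9 * kappa < `|f s - m|].

(** At every admissible pair of positions, a permutation off [m] by more than [9 kappa] is off its
    based coefficient by more than [3 kappa], or that coefficient is off [m] by more than [6 kappa].
    A base point is shared by at most [(n - 4)!] permutations of the coset. *)
Let card_off_value m :
  (#|off_value m| * ((n - 2) * (n - 3)) <= #|Z| + #|off_base m| * (n - 4)`!)%N.
Proof.
pose V := [set w : {perm T} * (T * T) | (w.1 \in off_value m) && uniq [:: w.2.1; w.2.2; a; e]].
have -> : (#|off_value m| * ((n - 2) * (n - 3)) = #|V|)%N.
  have uae : uniq [:: a; e] by rewrite /= inE ae.
  have -> : ((n - 2) * (n - 3) = (n - 2) * (n - 2).-1)%N by congr (_ * _)%N; lia.
  rewrite -(card_uniq_ext uae) -cardsX; apply: eq_card => -[s [x y]].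
  by rewrite in_setX [RHS]in_set [in X in _ && X = _]in_set.
pose base (w : {perm T} * (T * T)) := (w.2, (w.1 w.2.1, w.1 w.2.2)).
pose B := [set w in V | base w \in off_base m].
have VU : V \subset Z :|: B.
  apply/subsetP => -[s [x y]]; rewrite in_setU => wV.
  rewrite [X in _ || X]in_set wV /=; move: wV; rewrite in_set /= => /andP[].
  rewrite in_set => /andP[sc]; rewrite [X in X || _]in_set /= sc => hk -> /=.
  apply: contraTT hk; rewrite negb_or [X in _ && ~~ X]in_set -!leNgt /base /= => /andP[h1 h2].
  rewrite (_ : f s - m = (f s - based_coef (x, y, (s x, s y)) a b e d)
    + (based_coef (x, y, (s x, s y)) a b e d - m)); last by ring.
  rewrite (le_trans (ler_normD _ _)) // (_ : 9 * kappa = 3 * kappa + 6 * kappa); last by ring.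
  exact: lerD.
apply: leq_trans (subset_leq_card VU) _; apply: leq_trans (leq_card_setU _ _) _.
rewrite leq_add2l; apply: (card_partition_le (h := base)).
  by move=> w; rewrite in_set => /andP[].
move=> [[x y] [z w]] _.
have BP v : v \in [set v in B | base v == (x, y, (z, w))] ->
    [/\ map v.1 [:: x; y; a; e] = [:: z; w; b; d], uniq [:: x; y; a; e] & v = (v.1, (x, y))].
  case: v => s [x' y']; rewrite in_set => /andP[+ /eqP[<- <- <- <-]].
  rewrite in_set => /andP[+ _]; rewrite in_set => /andP[+ u]; rewrite in_set => /andP[+ _].
  by rewrite in_set => /andP[/eqP <- /eqP <-].
have [->|[v0 /BP[vm ur _]]] := set_0Vmem [set v in B | base v == (x, y, (z, w))].
  by rewrite cards0.
have uc : uniq [:: z; w; b; d] by rewrite -vm map_inj_uniq //; exact: perm_inj.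
rewrite -(card_perm_seq ur uc) //; apply: leq_trans (leq_imset_card (fun s => (s, (x, y))) _).
apply: subset_leq_card; apply/subsetP => v /BP[vs _ ->].
by apply/imsetP; exists v.1; rewrite // inE vs.
Qed.

Variable lam : R.
Hypotheses (n_ge : (24 <= n)%N) (heavy_le : #|heavy|%:R * n%:R ^+ 2 <= lam * (n`!)%:R).

(** Few pairs of base points disagree, by [card_J]. Take for [m] the coefficient at a base point
    with the fewest disagreements: almost all coefficients are then near [m], and so are almost all
    values of [f] on the coset. *)
Lemma coset_concentration : exists m,
  #|off_base m|%:R <= (12 * lam + 18) * n%:R ^+ 3 /\
  #|off_value m|%:R * n%:R <= (28 * lam + 36) * ((n - 2)`!)%:R.
Proof.
have n0 : 0 < (n%:R : R) by rewrite ltr0n; lia.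
have n24 : 24 <= (n%:R : R) by rewrite (ler_nat _ 24).
have nB k : (k <= 24)%N -> ((n - k)%:R = n%:R - k%:R :> R) by move=> ?; rewrite natrB //; lia.
have lam0 : 0 <= lam.
  have : 0 <= lam * (n`!)%:R by apply: le_trans heavy_le; rewrite mulr_ge0 ?exprn_ge0.
  by rewrite pmulr_lge0 // ltr0n fact_gt0.
have hZ : #|Z|%:R <= 3 * n%:R * #|heavy|%:R :> R by rewrite -!natrM ler_nat.
have hJ : #|J|%:R <= 6 * lam * n%:R ^+ 7.
  have f6 : ((n`!)%:R : R) <= n%:R ^+ 6 * ((n - 6)`!)%:R.
    rewrite -natrX -natrM ler_nat -(@ffact_fact n 6) ?leq_mul2r; last by lia.
    by apply/orP; right; apply: ffact_le_exp.
  have F0 : 0 < (((n - 6)`!)%:R : R) by rewrite ltr0n fact_gt0.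
  have hJ : ((n - 6)`!)%:R * #|J|%:R <= 2 * n%:R ^+ 2 * #|Z|%:R :> R.
    by rewrite -natrX -!natrM ler_nat.
  rewrite -(ler_pM2l F0); apply: le_trans hJ _.
  have h1 : 2 * n%:R ^+ 2 * #|Z|%:R <= 2 * n%:R ^+ 2 * (3 * n%:R * #|heavy|%:R) :> R.
    by rewrite ler_pM2l // mulr_gt0 // exprn_gt0.
  apply: le_trans h1 _.
  have h2 : 6 * n%:R * (#|heavy|%:R * n%:R ^+ 2) <= 6 * n%:R * (lam * (n`!)%:R).
    by rewrite ler_pM2l // mulr_gt0.
  have h3 : 6 * n%:R * (lam * (n`!)%:R) <= 6 * n%:R * (lam * (n%:R ^+ 6 * ((n - 6)`!)%:R)).
    by rewrite ler_pM2l ?mulr_gt0 // ler_wpM2l.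
  have := le_trans h2 h3; lra.
pose U1 := [set w : T * T | uniq [:: w.1; w.2; a; e]].
pose U2 := [set w : T * T | uniq [:: w.1; w.2; b; d]].
pose V := setX U1 U2.
have cV : #|V| = (((n - 2) * (n - 3)) ^ 2)%N.
  rewrite cardsX -mulnn /U1 /U2 !card_uniq_ext ?subn2 -?subn3 /= ?inE ?ae ?bd //.
  by rewrite -!subn1 -!subnDA.
have V0 : (0 < #|V|)%N by rewrite cV expn_gt0 muln_gt0 !subn_gt0 !(leq_trans _ n_ge).
have /card_gt0P[r0 r0V] := V0.
pose Jr r := [set w in J | w.1 == r].
case: (arg_minnP (P := [in V]) (fun r => #|Jr r|) r0V) => r1 r1V r1min.
have cJr : (#|V| * #|Jr r1| <= #|J|)%N.
  have := @card_partition_ge _ _ J (fun w => w.1) [in V] 1 #|Jr r1|.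
  by rewrite mul1n; apply=> w /r1min; rewrite mul1n.
exists (based_coef r1 a b e d); set m := based_coef _ _ _ _ _.
have off_sub : off_base m \subset (snd @: Jr r1) :|: ~: good r1.
  apply/subsetP => r; rewrite in_set in_setU in_setC => hr.
  have [rg|] := boolP (r \in good r1); rewrite ?orbT // orbF.
  by apply/imsetP; exists (r1, r) => //; rewrite in_set /= eqxx in_set /= rg hr.
have cgood : #|good r1| = (((n - 4) * (n - 5)) ^ 2)%N.
  have : (r1.1 \in U1) && (r1.2 \in U2) by rewrite -in_setX -surjective_pairing.
  rewrite in_set in_set => /andP[u1 u2].
  have -> : good r1 = setX [set w : T * T | uniq [:: w.1, w.2 & [:: r1.1.1; r1.1.2; a; e]]]
                           [set w : T * T | uniq [:: w.1, w.2 & [:: r1.2.1; r1.2.2; b; d]]].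
    by apply/setP => -[w w']; rewrite in_setX !in_set.
  rewrite cardsX -mulnn !card_uniq_ext //=.
  by rewrite -subn1 -!subnDA.
have cbad : #|~: good r1|%:R <= 18 * n%:R ^+ 3 :> R.
  have : (#|good r1| + #|~: good r1| = n ^ 4)%N by rewrite cardsC !card_prod !expnS expn0 muln1 !mulnA.
  move/(congr1 (fun k => k%:R : R)); rewrite natrD cgood !natrX natrM !nB // => h.
  have : n%:R ^+ 4 - 18 * n%:R ^+ 3 <= (((n%:R : R) - 4) * (n%:R - 5)) ^+ 2.
    move: (n%:R : R) n24 => N n24; have N24 : 0 <= N * (N - 24) by rewrite mulr_ge0; lra.
    apply: (@le_trans _ _ ((N ^+ 2 - 9 * N) ^+ 2)).
      rewrite -subr_ge0; have -> : (N ^+ 2 - 9 * N) ^+ 2 - (N ^+ 4 - 18 * N ^+ 3) = 81 * N ^+ 2 by ring.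
      by rewrite mulr_ge0 // sqr_ge0.
    by rewrite ler_sqr ?nnegrE; lra.
  lra.
have cB : #|off_base m|%:R <= (12 * lam + 18) * n%:R ^+ 3.
  have h1 : #|off_base m|%:R <= #|Jr r1|%:R + #|~: good r1|%:R :> R.
    rewrite -natrD ler_nat; apply: leq_trans (subset_leq_card off_sub) _.
    by apply: leq_trans (leq_card_setU _ _) _; rewrite leq_add2r leq_imset_card.
  have h2 : #|V|%:R * #|Jr r1|%:R <= 6 * lam * n%:R ^+ 7.
    by apply: le_trans hJ; rewrite -natrM ler_nat.
  have h3 : n%:R ^+ 4 / 2 <= #|V|%:R :> R.
    rewrite cV natrX natrM !nB //; move: (n%:R : R) n24 => N n24.
    have N24 : 0 <= N * (N - 24) by rewrite mulr_ge0; lra.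
    apply: (@le_trans _ _ ((N ^+ 2 * (3 / 4)) ^+ 2)).
      rewrite -subr_ge0; have -> : (N ^+ 2 * (3 / 4)) ^+ 2 - N ^+ 4 / 2 = N ^+ 4 / 16 by field.
      by rewrite divr_ge0 // exprn_ge0 //; lra.
    by rewrite ler_sqr ?nnegrE; lra.
  have h4 : n%:R ^+ 4 / 2 * #|Jr r1|%:R <= 6 * lam * n%:R ^+ 7.
    by apply: le_trans h2; rewrite ler_wpM2r.
  have n4 : 0 < n%:R ^+ 4 / 2 :> R by rewrite divr_gt0 // exprn_gt0.
  have : #|Jr r1|%:R <= 12 * lam * n%:R ^+ 3.
    by rewrite -(ler_pM2l n4); apply: le_trans h4 _; rewrite le_eqVlt; apply/orP; left; apply/eqP; field.
  lra.
split=> //.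
have h := card_off_value m; move: h; set K := #|off_value m|.
rewrite -(ler_nat R) natrD !natrM !nB // => h.
have f2 : ((n`!)%:R : R) = n%:R * (n%:R - 1) * ((n - 2)`!)%:R.
  by rewrite fact_pred2 ?natrM ?nB // (leq_trans _ n_ge).
have f4 : (((n - 2)`!)%:R : R) = (n%:R - 2) * (n%:R - 3) * ((n - 4)`!)%:R.
  rewrite fact_pred2 ?natrM -?subnDA ?nB // ltn_subRL (leq_trans _ n_ge) //.
have F2 : 0 < (((n - 2)`!)%:R : R) by rewrite ltr0n fact_gt0.
have F4 : 0 < (((n - 4)`!)%:R : R) by rewrite ltr0n fact_gt0.
have k_ge0 : 0 <= (K%:R : R) by [].
move: f2 f4 F2 F4 h cB hZ heavy_le k_ge0; rewrite -/K.
move: ((n`!)%:R : R) (((n - 2)`!)%:R : R) (((n - 4)`!)%:R : R) (K%:R : R) (#|off_base m|%:R : R)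
  (#|Z|%:R : R) (#|heavy|%:R : R) (n%:R : R) n0 n24 => A0 A2 A4 k B z H N n0 n24 f2 f4 F2 F4 h hB hz hH k_ge0.
have zB : z <= 3 * lam * (N - 1) * A2.
  rewrite -(ler_pM2l n0); have : N * z <= N * (3 * N * H) by rewrite ler_pM2l.
  by rewrite f2 in hH; lra.
have N24 : 0 <= N * (N - 24) by rewrite mulr_ge0; lra.
have hM : N ^+ 2 * (3 / 4) <= (N - 2) * (N - 3) by lra.
have M0 : 0 < (N - 2) * (N - 3) by rewrite mulr_gt0; lra.
set M := (N - 2) * (N - 3) in f4 h hM M0 *.
have h1 : k * M ^+ 2 <= (z + B * A4) * M by rewrite expr2 mulrA ler_pM2r.
have h2 : z * M <= 3 * lam * N * A2 * N ^+ 2.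
  have : z * M <= 3 * lam * (N - 1) * A2 * M by rewrite ler_pM2r.
  move/le_trans; apply; apply: ler_pM.
  - by rewrite !mulr_ge0 ?(ltW F2) // subr_ge0; lra.
  - exact: ltW.
  - by rewrite ler_pM2r // ler_wpM2l ?mulr_ge0 //; lra.
  - by rewrite /M; lra.
have h3 : B * A4 * M <= (12 * lam + 18) * N ^+ 3 * A2.
  by rewrite f4 -mulrA [A4 * M]mulrC ler_pM2r // mulr_gt0.
have h4 : k * M ^+ 2 <= (15 * lam + 18) * A2 * N ^+ 3 by lra.
(* Dividing by [M ^+ 2] costs a factor [16 / 9], which takes [15 * lam + 18] to less than
   [28 * lam + 36]. *)
have h5 : N ^+ 4 * (9 / 16) <= M ^+ 2.
  have -> : N ^+ 4 * (9 / 16) = (N ^+ 2 * (3 / 4)) ^+ 2 by field.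
  by rewrite ler_sqr ?nnegrE ?(ltW M0) // mulr_ge0 ?exprn_ge0 ?(ltW n0) //; lra.
have h6 : k * (N ^+ 4 * (9 / 16)) <= (15 * lam + 18) * A2 * N ^+ 3.
  by apply: le_trans h4; rewrite ler_wpM2l.
have N3 : 0 < N ^+ 3 by rewrite exprn_gt0.
have h7 : k * N * (9 / 16) <= (15 * lam + 18) * A2.
  by rewrite -(ler_pM2r N3); apply: le_trans h6; rewrite le_eqVlt; apply/orP; left; apply/eqP; ring.
have h8 : 0 <= lam * A2 by rewrite mulr_ge0 // ltW.
lra.
Qed.

End Coset.
End Concentration.

Lemma card_bigcup_le (I T : finType) (F : I -> {set T}) :
  (#|\bigcup_i F i| <= \sum_i #|F i|)%N.
Proof.
elim/big_rec2: _ => [|i m S _ IH]; first by rewrite cards0.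
by apply: leq_trans (leq_card_setU _ _) _; rewrite leq_add2l.
Qed.

Lemma card_coset3 (T : finType) (u v w : T * T) : u != v -> u != w -> v != w ->
  (#|[set s : {perm T} | [&& s u.1 == u.2, s v.1 == v.2 & s w.1 == w.2]]| <= (#|T| - 3)`!)%N.
Proof.
case: u v w => [x x'] [y y'] [z z'] /= uv uw vw.
have [->|[s0]] := set_0Vmem [set s : {perm T} | [&& s x == x', s y == y' & s z == z']].
  by rewrite cards0.
rewrite in_set => /and3P[/eqP sx /eqP sy /eqP sz].
have ur : uniq [:: x; y; z].
  rewrite /= !inE negb_or andbT; apply/andP; split; first apply/andP; first split.
  - by apply: contraNneq uv => xy; rewrite -sx -sy xy.
  - by apply: contraNneq uw => xz; rewrite -sx -sz xz.
  - by apply: contraNneq vw => yz; rewrite -sy -sz yz.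
have uc : uniq [:: x'; y'; z'].
  by rewrite -sx -sy -sz -[[:: _; _; _]]/(map s0 [:: x; y; z]) map_inj_uniq //; exact: perm_inj.
rewrite -(card_perm_seq ur uc) // subset_leq_card //; apply/subsetP => s.
by rewrite !in_set /= => /and3P[/eqP-> /eqP-> /eqP->].
Qed.

(** * Typical values of cosets, and the number of heavy cosets *)

Section Coefficients.
Variables (R : realFieldType) (T : finType) (c : T -> T -> T -> T -> R).
Variables (f : {perm T} -> R) (k0 : R).
Hypothesis f_quad : forall s, f s = quad_sum c s + k0.
Local Notation n := #|T|.
Variables (kappa lam : R).
Hypotheses (n_ge : (24 <= n)%N).
Hypothesis heavy_le : #|heavy f kappa|%:R * n%:R ^+ 2 <= lam * (n`!)%:R.

Definition coset_values (M : T -> T -> T -> T -> R) :=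
  forall a b e d, a != e -> b != d ->
  #|off_base c kappa a b e d (M a b e d)|%:R <= (12 * lam + 18) * n%:R ^+ 3 /\
  #|off_value f kappa a b e d (M a b e d)|%:R * n%:R <= (28 * lam + 36) * ((n - 2)`!)%:R.

Lemma exists_coset_values : exists M, coset_values M.
Proof.
pose P (w : (T * T) * (T * T)) m := w.1.1 != w.2.1 -> w.1.2 != w.2.2 ->
  #|off_base c kappa w.1.1 w.1.2 w.2.1 w.2.2 m|%:R <= (12 * lam + 18) * n%:R ^+ 3 /\
  #|off_value f kappa w.1.1 w.1.2 w.2.1 w.2.2 m|%:R * n%:R <= (28 * lam + 36) * ((n - 2)`!)%:R.
have : forall w, exists m, P w m.
  move=> [[a b] [e d]]; rewrite /P /=.
  have [->|ae] := eqVneq a e; first by exists 0.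
  have [->|bd] := eqVneq b d; first by exists 0.
  by have [m hm] := coset_concentration f_quad ae bd n_ge heavy_le; exists m.
move=> /fin_all_exists[M hM]; exists (fun a b e d => M ((a, b), (e, d))).
by move=> a b e d; exact: (hM ((a, b), (e, d))).
Qed.

Variable M : T -> T -> T -> T -> R.
Hypothesis M_val : coset_values M.

(** Each of the sixteen cosets involved rules out at most [(12 * lam + 18) * n ^ 3] base points, so
    some base point suits them all. With it, each of the sixteen terms of [second_diff_ref] is off
    by at most [6 kappa]. *)
Lemma second_diff_approx a a' b b' e e' d d' :
  16 * (12 * lam + 18) < n%:R ->
  [/\ a != e, a != e', a' != e & a' != e'] ->
  [/\ b != d, b != d', b' != d & b' != d'] ->
  `|second_diff c a a' b b' e e' d d'
    - cross (fun x k => cross (M x k) e e' d d') a a' b b'| <= 96 * kappa.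
Proof.
move=> n_big [ae ae' a'e a'e'] [bd bd' b'd b'd'].
pose x (i : bool) := if i then a else a'; pose k (i : bool) := if i then b else b'.
pose y (i : bool) := if i then e else e'; pose l (i : bool) := if i then d else d'.
pose F (i : (bool * bool) * (bool * bool)) :=
  off_base c kappa (x i.1.1) (k i.1.2) (y i.2.1) (l i.2.2)
    (M (x i.1.1) (k i.1.2) (y i.2.1) (l i.2.2)).
have n0 : 0 < (n%:R : R) by rewrite ltr0n (leq_trans _ n_ge).
have cF i : #|F i|%:R <= (12 * lam + 18) * n%:R ^+ 3.
  by case: i => [[[] []] [[] []]]; rewrite /F /=; refine (proj1 (M_val _ _)).
have : (#|\bigcup_i F i| < n ^ 4)%N.
  apply: leq_ltn_trans (card_bigcup_le F) _; rewrite -(ltr_nat R) natr_sum natrX.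
  apply: (@le_lt_trans _ _ (\sum_(i : (bool * bool) * (bool * bool)) (12 * lam + 18) * n%:R ^+ 3)).
    exact: ler_sum.
  have n3 : 16 * (12 * lam + 18) * n%:R ^+ 3 < n%:R * n%:R ^+ 3.
    by rewrite ltr_pM2r // exprn_gt0.
  rewrite exprS; apply: le_lt_trans n3; rewrite sumr_const !card_prod card_bool.
  by rewrite -mulr_natr -[(_ * _)%N]/16%N; lra.
have -> : (n ^ 4 = #|{: (T * T) * (T * T)}|)%N.
  by rewrite !card_prod !expnS expn0 muln1 !mulnA.
rewrite -cardsT => hlt.
have /subsetPn[r _ rF] : ~~ ([set: (T * T) * (T * T)] \subset \bigcup_i F i).
  by apply: contraTN hlt => /subset_leq_card; rewrite -leqNgt.
have rP i1 i2 i3 i4 : `|based_coef c r (x i1) (k i2) (y i3) (l i4)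
    - M (x i1) (k i2) (y i3) (l i4)| <= 6 * kappa.
  rewrite leNgt; apply: contra rF => hr; apply/bigcupP; exists ((i1, i2), (i3, i4)) => //.
  by rewrite in_set.
rewrite (second_diff_ref c r.1.1 r.2.1 r.1.2 r.2.2) /cross.
have h1111 := rP true true true true; have h1110 := rP true true true false.
have h1101 := rP true true false true; have h1100 := rP true true false false.
have h1011 := rP true false true true; have h1010 := rP true false true false.
have h1001 := rP true false false true; have h1000 := rP true false false false.
have h0111 := rP false true true true; have h0110 := rP false true true false.
have h0101 := rP false true false true; have h0100 := rP false true false false.
have h0011 := rP false false true true; have h0010 := rP false false true false.
have h0001 := rP false false false true; have h0000 := rP false false false false.
clear rP; move: h1111 h1110 h1101 h1100 h1011 h1010 h1001 h1000
  h0111 h0110 h0101 h0100 h0011 h0010 h0001 h0000.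
rewrite /based_coef /x /k /y /l !ler_norml.
do 16 (move=> /andP[? ?]).
by apply/andP; split; lra.
Qed.

Section Values.
Variables a b e d : T.
Hypotheses (ae : a != e) (bd : b != d).

Lemma card_coset2 : #|coset2 a b e d| = (n - 2)`!.
Proof.
have ur : uniq [:: a; e] by rewrite /= inE ae.
have uc : uniq [:: b; d] by rewrite /= inE bd.
rewrite -(card_perm_seq ur uc) //; apply: eq_card => s; rewrite !in_set /=.
by apply/andP/eqP => [[/eqP-> /eqP->]|[-> ->]].
Qed.

Lemma coset_value_near (P : {perm T} -> bool) eta :
  28 * lam + 36 <= eta * n%:R ->
  (forall s, s \in coset2 a b e d -> `|f s - M a b e d| <= 9 * kappa -> P s) ->
  (1 - eta) * ((n - 2)`!)%:R <= #|[set s in coset2 a b e d | P s]|%:R.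
Proof.
move=> n_big hP; have [_ hoff] := M_val ae bd.
have n0 : 0 < (n%:R : R) by rewrite ltr0n (leq_trans _ n_ge).
have sub : coset2 a b e d \subset
    off_value f kappa a b e d (M a b e d) :|: [set s in coset2 a b e d | P s].
  apply/subsetP => s sc; rewrite in_setU [s \in off_value _ _ _ _ _ _ _]in_set.
  rewrite [X in _ || X]in_set sc /=.
  by have [//|h] := ltP (9 * kappa) `|f s - M a b e d|; rewrite hP.
have : (#|coset2 a b e d| <= #|off_value f kappa a b e d (M a b e d)|
    + #|[set s in coset2 a b e d | P s]|)%N.
  by apply: leq_trans (subset_leq_card sub) (leq_card_setU _ _).
rewrite card_coset2 -(ler_nat R) natrD.
have : #|off_value f kappa a b e d (M a b e d)|%:R <= eta * ((n - 2)`!)%:R.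
  rewrite -(ler_pM2r n0); apply: le_trans hoff _.
  by rewrite mulrAC ler_pM2r // ltr0n fact_gt0.
lra.
Qed.

(** A larger value would force [|f| > 2 * L] on at least half of a coset, whose share of the group
    is at least [1 / n ^ 2], against the L1 bound. *)
Lemma coset_value_bound L : 0 <= kappa -> 2 * (28 * lam + 36) <= n%:R ->
  (\sum_s `|f s|) * n%:R ^+ 2 <= L * (n`!)%:R -> `|M a b e d| <= 2 * L + 9 * kappa.
Proof.
move=> kappa0 n_big hL; rewrite leNgt; apply/negP => hM.
have F0 : 0 < (((n - 2)`!)%:R : R) by rewrite ltr0n fact_gt0.
have n0 : 0 < (n%:R : R) by rewrite ltr0n (leq_trans _ n_ge).
have L0 : 0 <= L.
  have : 0 <= L * (n`!)%:R.
    by apply: le_trans hL; rewrite mulr_ge0 ?exprn_ge0 // sumr_ge0.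
  by rewrite pmulr_lge0 // ltr0n fact_gt0.
pose C := [set s in coset2 a b e d | `|M a b e d| - 9 * kappa <= `|f s|].
have cC : (1 - 1 / 2) * ((n - 2)`!)%:R <= #|C|%:R :> R.
  apply: coset_value_near; first by lra.
  move=> s _ h.
  by have := lerB_dist (M a b e d) (f s); rewrite distrC; lra.
have h1 : #|C|%:R * (`|M a b e d| - 9 * kappa) <= \sum_s `|f s|.
  rewrite mulr_natl -sumr_const [leRHS](bigID (mem C)) /= ler_wpDr ?sumr_ge0 //.
  by apply: ler_sum => s; rewrite in_set => /andP[].
have h2 : L * ((n - 2)`!)%:R < \sum_s `|f s|.
  apply: lt_le_trans h1; apply: (@lt_le_trans _ _ (((n - 2)`!)%:R / 2 * (`|M a b e d| - 9 * kappa))).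
    have : ((n - 2)`!)%:R * (2 * L) < ((n - 2)`!)%:R * (`|M a b e d| - 9 * kappa).
      by rewrite ltr_pM2l //; lra.
    lra.
  by apply: ler_wpM2r; lra.
have h3 : (n`!)%:R <= n%:R ^+ 2 * ((n - 2)`!)%:R :> R.
  rewrite -natrX -natrM ler_nat fact_pred2 ?(leq_trans _ n_ge) // leq_mul2r.
  by apply/orP; right; rewrite -mulnn leq_mul2l leq_subr orbT.
have : L * (n`!)%:R < L * (n`!)%:R.
  apply: (@le_lt_trans _ _ (L * ((n - 2)`!)%:R * n%:R ^+ 2)).
    by rewrite -mulrA ler_wpM2l // mulrC.
  by apply: lt_le_trans hL; rewrite ltr_pM2r // exprn_gt0.
by rewrite ltxx.
Qed.

End Values.

(** A coset appears here once for each order of its two constraints. *)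
Definition heavy_cosets := [set w : (T * T) * (T * T) |
  [&& w.1.1 != w.2.1, w.1.2 != w.2.2 &
      ((n - 2)`! <= 2 * #|heavy f kappa :&: coset2 w.1.1 w.1.2 w.2.1 w.2.2|)%N]].

Let inc (w : (T * T) * (T * T)) (s : {perm T}) := s \in coset2 w.1.1 w.1.2 w.2.1 w.2.2.

(** Only [w] and its swap describe the coset of [w]. Any other entry adds to the two constraints of
    [w] a third one, which leaves at most [(n - 3)!] permutations. *)
Lemma card_coset2I w : w \in heavy_cosets ->
  (\sum_(v in heavy_cosets) \sum_s (inc w s && inc v s) <=
   2 * (n - 2)`! + #|heavy_cosets| * (n - 3)`!)%N.
Proof.
move=> wN; have := wN; rewrite in_set => /and3P[w1 w2 _].
have cw : (\sum_s inc w s = (n - 2)`!)%N.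
  by rewrite -(card_coset2 w1 w2) -sum1_card [RHS]big_mkcond.
have le1 v : (\sum_s (inc w s && inc v s) <= (n - 2)`!)%N.
  by rewrite -cw; apply: leq_sum => s _; case: (inc w s) => //; case: (inc v s).
pose sw := (w.2, w.1).
apply: (@leq_trans (\sum_(v in heavy_cosets)
   ((v == w) * (n - 2)`! + (v == sw) * (n - 2)`! + (n - 3)`!))%N).
  apply: leq_sum => v vN; have := vN; rewrite in_set => /and3P[v1 v2 _].
  have [->|vw] := eqVneq v w; first by rewrite mul1n -addnA (leq_trans (le1 _)) // leq_addr.
  have [->|vsw] := eqVneq v sw; first by rewrite mul0n add0n mul1n (leq_trans (le1 _)) // leq_addr.
  rewrite !mul0n !add0n.
  have w12 : w.1 != w.2 by apply: contraNneq w1 => ->.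
  have v12 : v.1 != v.2 by apply: contraNneq v1 => ->.
  have [u [uw1 uw2 uE]] : exists u : T * T, [/\ w.1 != u, w.2 != u &
      forall s, inc v s -> s u.1 == u.2].
    have [h1|h1] := boolP ((v.1 == w.1) || (v.1 == w.2)).
      exists v.2; rewrite ![_ == v.2]eq_sym; split=> [||s]; last by rewrite /inc in_set => /andP[].
      - apply: contraNneq vw => e; case/orP: h1 => /eqP h; first by rewrite h e eqxx in v12.
        by case/eqP: vsw; rewrite /sw -e -h -surjective_pairing.
      - apply: contraNneq vsw => e; case/orP: h1 => /eqP h; last by rewrite h e eqxx in v12.
        by case/eqP: vw; rewrite [v]surjective_pairing e h -surjective_pairing.
    move: h1; rewrite negb_or => /andP[h1 h2]; exists v.1; rewrite ![_ == v.1]eq_sym.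
    by split=> // s; rewrite /inc in_set => /andP[].
  apply: leq_trans (card_coset3 w12 uw1 uw2); rewrite -sum1_card [leqRHS]big_mkcond /=.
  apply: leq_sum => s _.
  have [ws|//] := boolP (inc w s); have [vs|//] := boolP (inc v s).
  by move: ws; rewrite /inc !in_set (uE s vs) andbT => /andP[-> ->].
rewrite !big_split /= sum_nat_const leq_add2r.
have le_one (u : (T * T) * (T * T)) m : (\sum_(v in heavy_cosets) (v == u) * m <= m)%N.
  rewrite -big_distrl /= -[leqRHS]mul1n leq_mul2r; apply/orP; right.
  rewrite big_mkcond (bigD1 u) //= eqxx big1 ?addn0; first by case: ifP.
  by move=> v /negPf->; case: ifP.
by rewrite mul2n -addnn leq_add.
Qed.

(* Second moment: with [N s] the number of heavy cosets through [s], combine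
   [8 lam x N <= x^2 + 16 lam^2 N^2] ([x] the number of heavy cosets), summed over heavy [s]. *)
Lemma card_heavy_cosets : 0 < lam -> 16 * lam + 2 <= n%:R -> #|heavy_cosets|%:R <= 16 * lam.
Proof.
move=> lam0 n_big; set x := #|heavy_cosets|.
pose N s := (\sum_(w in heavy_cosets) inc w s)%N.
have h1 : (x * (n - 2)`! <= 2 * \sum_(s in heavy f kappa) N s)%N.
  rewrite exchange_big /= big_distrr /= -sum_nat_const; apply: leq_sum => w.
  rewrite in_set => /and3P[_ _ h]; apply: leq_trans h _; rewrite leq_mul2l /=.
  rewrite -sum1_card [leqLHS]big_mkcond [leqRHS]big_mkcond /=; apply: leq_sum => s _.
  by rewrite in_setI; case: (s \in heavy f kappa).
have h2 : (\sum_s N s ^ 2 <= x * (2 * (n - 2)`! + x * (n - 3)`!))%N.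
  rewrite (eq_bigr (fun s => \sum_(w in heavy_cosets) \sum_(v in heavy_cosets)
     (inc w s && inc v s))%N); last first.
    move=> s _; rewrite -mulnn big_distrl /=; apply: eq_bigr => w _; rewrite big_distrr /=.
    by apply: eq_bigr => v _; rewrite mulnb.
  rewrite exchange_big /= -sum_nat_const; apply: leq_sum => w wN.
  by rewrite exchange_big /=; apply: card_coset2I.
set F : R := ((n - 2)`!)%:R; have F0 : 0 < F by rewrite ltr0n fact_gt0.
have n0 : 0 < (n%:R : R) by rewrite ltr0n (leq_trans _ n_ge).
have n2 : ((n - 2)%:R : R) = n%:R - 2 by rewrite natrB // (leq_trans _ n_ge).
have n2_gt0 : 0 < (n%:R : R) - 2 by lra.
have h3 : ((n - 3)`!)%:R = F / (n%:R - 2) :> R.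
  have : ((n - 2)`! = (n - 2) * (n - 3)`!)%N.
    by case: #|T| n_ge => [|[|[|m]]] // _; rewrite !subSS !subn0 factS.
  by move/(congr1 (fun k => k%:R : R)); rewrite natrM n2 -/F => ->; field; lra.
have hH : #|heavy f kappa|%:R <= lam * F.
  rewrite -(@ler_pM2r _ (n%:R ^+ 2)) ?exprn_gt0 //; apply: le_trans heavy_le _.
  rewrite -mulrA ler_pM2l // mulrC -natrX -natrM ler_nat fact_pred2 ?(leq_trans _ n_ge) //.
  by rewrite leq_mul2r -mulnn leq_mul2l leq_subr !orbT.
have r1 : x%:R * F <= 2 * \sum_(s in heavy f kappa) (N s)%:R.
  by rewrite -natr_sum -[2]/(2%:R) -!natrM ler_nat.
have r2 : \sum_s (N s)%:R ^+ 2 <= x%:R * (2 * F + x%:R * (F / (n%:R - 2))).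
  rewrite -h3 -[2]/(2%:R) -!natrM -natrD -natrM.
  by rewrite (eq_bigr (fun s => (N s ^ 2)%:R)) -?natr_sum ?ler_nat // => s _; rewrite natrX.
have r3 : 8 * lam * x%:R * \sum_(s in heavy f kappa) (N s)%:R <=
    x%:R ^+ 2 * #|heavy f kappa|%:R + 16 * lam ^+ 2 * \sum_s (N s)%:R ^+ 2.
  apply: (@le_trans _ _ (\sum_(s in heavy f kappa) (x%:R ^+ 2 + 16 * lam ^+ 2 * (N s)%:R ^+ 2))).
    rewrite mulr_sumr; apply: ler_sum => s _.
    by have := sqr_ge0 (x%:R - 4 * lam * (N s)%:R); lra.
  rewrite big_split /= sumr_const mulr_natr lerD2l -mulr_sumr ler_wpM2l ?mulr_ge0 ?(ltW lam0) //.
  by rewrite [leRHS](bigID (mem (heavy f kappa))) /= ler_wpDr // sumr_ge0 // => s _; rewrite sqr_ge0.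
have x0 : 0 <= (x%:R : R) by [].
move: r1 r2 r3 hH x0; set S1 := \sum_(s in _) _; set S2 := \sum_s _.
move: (x%:R : R) (#|heavy f kappa|%:R : R) => y H r1 r2 r3 hH y0.
have q1 : 4 * lam * y * (y * F) <= 8 * lam * y * S1.
  have : 4 * lam * y * (y * F) <= 4 * lam * y * (2 * S1).
    by rewrite ler_wpM2l // !mulr_ge0 // ltW.
  lra.
have q2 : y ^+ 2 * H <= y ^+ 2 * (lam * F) by rewrite ler_wpM2l // sqr_ge0.
have q3 : 16 * lam ^+ 2 * S2 <= 16 * lam ^+ 2 * (y * (2 * F + y * (F / (n%:R - 2)))).
  by rewrite ler_pM2l // mulr_gt0 // exprn_gt0.
(* The lower bound on [n] enters here: the part of the second moment that is quadratic in the number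
   of cosets can be absorbed on the left. *)
have q4 : 16 * lam * (F / (n%:R - 2)) <= F.
  by rewrite mulrA ler_pdivrMr // mulrC ler_pM2l //; lra.
have q5 : lam * y ^+ 2 * (16 * lam * (F / (n%:R - 2))) <= lam * y ^+ 2 * F.
  by rewrite ler_wpM2l // mulr_ge0 ?sqr_ge0 // ltW.
have q6 : lam * F * (2 * y ^+ 2) <= lam * F * (32 * lam * y) by lra.
have lF : 0 < lam * F by rewrite mulr_gt0.
rewrite ler_pM2l // in q6.
have [->|yn0] := eqVneq y 0; first by rewrite mulr_ge0 // ltW.
have yp : 0 < 2 * y by rewrite mulr_gt0 // lt_neqAle eq_sym yn0.
by rewrite -(ler_pM2r yp); lra.
Qed.

End Coefficients.

(** * Expansion along disjoint transpositions *)

Section Pairs.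
Variable A : Type.

Fixpoint pairs (s : seq A) : seq (A * A) :=
  if s is x :: s' then [seq (x, y) | y <- s'] ++ pairs s' else [::].

Lemma size_pairs s : size (pairs s) = 'C(size s, 2).
Proof. by elim: s => //= x s IHs; rewrite size_cat size_map IHs binS bin1 addnC. Qed.

End Pairs.

Lemma pairs_map (A B : Type) (g : A -> B) s :
  pairs (map g s) = [seq (g w.1, g w.2) | w <- pairs s].
Proof.
elim: s => //= x s ->; rewrite map_cat -!map_comp; congr (_ ++ _).
Qed.

Lemma pairs_neq (A : eqType) (s : seq A) w : uniq s -> w \in pairs s -> w.1 != w.2.
Proof.
elim: s => //= x s IHs /andP[xs us]; rewrite mem_cat => /orP[/mapP[y ys ->]|]; last exact: IHs.
by apply: contraNneq xs => /= ->.
Qed.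

Section Swaps.
Variable T : finType.
Implicit Types (s : seq (T * T)) (t : T * T) (p q sg : {perm T}).

Definition swaps s : {perm T} := foldr (fun t p => tperm t.1 t.2 * p)%g 1%g s.
Definition moved s : seq T := flatten [seq [:: t.1; t.2] | t <- s].

Lemma swaps_out s z : z \notin moved s -> swaps s z = z.
Proof.
elim: s => [|t s IHs]; first by rewrite perm1.
rewrite /= !inE !negb_or => /and3P[z1 z2 zs].
by rewrite permM tpermD 1?eq_sym // IHs.
Qed.

Lemma moved_mem s t : t \in s -> (t.1 \in moved s) && (t.2 \in moved s).
Proof.
elim: s => //= u s IHs; rewrite !inE => /predU1P[->|/IHs/andP[-> ->]]; rewrite ?eqxx ?orbT //.
Qed.

Lemma swaps_in s t : uniq (moved s) -> t \in s ->
  swaps s t.1 = t.2 /\ swaps s t.2 = t.1.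
Proof.
elim: s => //= u s IHs; rewrite !inE negb_or => /and3P[/andP[u12 u1] u2 us].
rewrite !permM => /predU1P[->|ts]; first by rewrite tpermL tpermR !swaps_out.
have /andP[t1 t2] := moved_mem ts.
by rewrite !tpermD; first exact: IHs; apply: contraTneq isT => e;
  move: u1 u2; rewrite e ?t1 ?t2.
Qed.

Lemma swapsK s : uniq (moved s) -> (swaps s * swaps s = 1)%g.
Proof.
move=> us; apply/permP => z; rewrite permM perm1.
have [|zs] := boolP (z \in moved s); last by rewrite !swaps_out.
case/flatten_mapP => t /(swaps_in us)[t1 t2]; rewrite !inE => /pred2P[]->.
  by rewrite t1 t2.
by rewrite t2 t1.
Qed.

Lemma uniq_moved (I : eqType) (i p : I -> T) (ls : seq I) : uniq ls ->
  injective i -> injective p -> (forall l m, i l != p m) ->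
  uniq (moved [seq (i l, p l) | l <- ls]).
Proof.
move=> uls inji injp ip; elim: ls uls => //= l ls IHs /andP[lls /IHs ->].
have out (x : I -> T) : injective x -> (x = i \/ x = p) ->
    x l \notin moved [seq (i l, p l) | l <- ls].
  move=> injx xip; apply/negP => /flatten_mapP[t /mapP[m mls ->]]; rewrite !inE /=.
  have ml : m != l by apply: contraNneq lls => <-.
  case: xip injx => -> injx /pred2P[] e.
  - by rewrite (injx _ _ e) eqxx in ml.
  - by have := ip l m; rewrite e eqxx.
  - by have := ip m l; rewrite e eqxx.
  - by rewrite (injx _ _ e) eqxx in ml.
rewrite inE negb_or ip andbT !out //; [by right | by left].
Qed.

End Swaps.

Section Expansion.
Variables (R : realFieldType) (T : finType) (c : T -> T -> T -> T -> R).
Variables (f : {perm T} -> R) (k0 : R).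
Hypothesis f_quad : forall s, f s = quad_sum c s + k0.
Implicit Types (t : T * T) (p q sg : {perm T}).
Local Notation n := #|T|.

Definition swap_diff sg (w : (T * T) * (T * T)) :=
  second_diff c w.1.1 w.1.2 (sg w.1.1) (sg w.1.2) w.2.1 w.2.2 (sg w.2.1) (sg w.2.2).

Lemma swaps_coupling s t sg : uniq (moved (t :: s)) ->
  f (tperm t.1 t.2 * (swaps s * sg))%g = f (tperm t.1 t.2 * sg)%g + f (swaps s * sg)%g - f sg
    + \sum_(t' <- s) swap_diff sg (t, t').
Proof.
elim: s => [|u s IHs] ut; first by rewrite /= mul1g big_nil; ring.
have uu : uniq [:: t.1; t.2; u.1; u.2].
  by move: ut; rewrite -[moved _]/([:: t.1; t.2; u.1; u.2] ++ moved s) cat_uniq => /and3P[].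
have uts : uniq (moved (t :: s)).
  apply: subseq_uniq ut; rewrite -[moved (t :: s)]/([:: t.1; t.2] ++ moved s).
  rewrite -[moved (t :: u :: s)]/([:: t.1; t.2] ++ [:: u.1; u.2] ++ moved s).
  by rewrite cat_subseq // suffix_subseq.
(* The remaining swaps avoid these four points, so the second difference can be evaluated at
   [sg]. *)
have us : forall z, z \in [:: t.1; t.2; u.1; u.2] -> (swaps s * sg)%g z = sg z.
  move=> z zt; rewrite permM swaps_out //; move: ut.
  rewrite -[moved _]/([:: t.1; t.2; u.1; u.2] ++ moved s) cat_uniq => /and3P[_ /hasPn h _].
  by apply: contraL zt => /h.
have := second_diff_perm f_quad (swaps s * sg)%g uu; rewrite !us ?inE ?eqxx ?orbT //.
have := IHs uts; rewrite big_cons /= !mulgA /swap_diff /= => -> h.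
by rewrite -h; ring.
Qed.

(** A quadratic objective has no interactions of order three, so its expansion along disjoint
    transpositions stops at pairs. *)
Lemma swaps_expansion s sg : uniq (moved s) ->
  f (swaps s * sg)%g = f sg + \sum_(t <- s) (f (tperm t.1 t.2 * sg)%g - f sg)
    + \sum_(w <- pairs s) swap_diff sg w.
Proof.
elim: s => [|t s IHs] us; first by rewrite /= mul1g !big_nil; ring.
have us' : uniq (moved s) by move: us; rewrite /= => /and3P[].
rewrite /= big_cons big_cat /= big_map -mulgA swaps_coupling // IHs //.
set S1 := \sum_(t0 <- s) (_ - _); set S2 := \sum_(w <- _) _; set S3 := \sum_(t' <- s) _.
by rewrite -/S1 -/S2 -/S3; ring.
Qed.

Section Unfixing.
Variable k : nat.
Implicit Types i x : {ffun 'I_k -> T}.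

(* [i] enumerates the fixed points of [p] and [x] pairs each of them with a moved
   point; undoing the fixed points means composing with all [tperm (i l) (x l)]. *)
Definition fix_choices p : {set {ffun 'I_k -> T} * {ffun 'I_k -> T}} :=
  setX [set i in ffun_on [in fixset p] | injectiveb i]
       [set x in ffun_on [in ~: fixset p] | injectiveb x].

Lemma card_fix_choices p : p \in perm_class T k ->
  #|fix_choices p| = (k`! * (n - k) ^_ k)%N.
Proof.
move=> /perm_classP[pk _]; rewrite cardsX !card_inj_ffuns_on card_ord.
by rewrite pk ffactnn cardsCs setCK pk.
Qed.

Definition swap_seq i x := [seq (i l, x l) | l <- enum 'I_k].
Definition swap_all i x := swaps (swap_seq i x).

Section Choice.
Variables (p : {perm T}) (i x : {ffun 'I_k -> T}).
Hypotheses (pk : p \in perm_class T k) (ix : (i, x) \in fix_choices p).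

Lemma fix_choicesP : [/\ injective i, injective x, forall l, p (i l) = i l,
  forall l, p (x l) != x l & forall z, p z = z -> exists l, z = i l].
Proof.
move: ix; rewrite in_setX !in_set => /andP[/andP[/ffun_onP iF /injectiveP inji]].
move=> /andP[/ffun_onP xF /injectiveP injx]; split=> //.
- by move=> l; have := iF l; rewrite inE => /eqP.
- by move=> l; have := xF l; rewrite !inE.
move=> z /eqP pz; have [pc _] := perm_classP _ _ pk.
have im : i @: [set: 'I_k] = fixset p.
  apply/eqP; rewrite eqEcard card_imset // cardsT card_ord pc leqnn andbT.
  by apply/subsetP => _ /imsetP[l _ ->]; exact: iF.
have : z \in i @: [set: 'I_k] by rewrite im inE.
by case/imsetP => l _ ->; exists l.
Qed.

Lemma fix_choices_neq l m : i l != x m.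
Proof.
have [_ _ pi px _] := fix_choicesP.
by apply: contraNneq (px m) => <-; rewrite pi.
Qed.

Lemma uniq_swap_seq : uniq (moved (swap_seq i x)).
Proof.
have [inji injx _ _ _] := fix_choicesP.
by apply: uniq_moved => //; [rewrite enum_uniq | exact: fix_choices_neq].
Qed.

Lemma swap_all_val l : swap_all i x (i l) = x l /\ swap_all i x (x l) = i l.
Proof.
apply: (swaps_in (t := (i l, x l)) uniq_swap_seq).
by apply/mapP; exists l; rewrite ?mem_enum.
Qed.

Lemma swap_all_out z : (forall l, z != i l) -> (forall l, z != x l) -> swap_all i x z = z.
Proof.
move=> zi zx; apply: swaps_out; apply/flatten_mapP => -[t /mapP[l _ ->]].
by rewrite !inE /= (negPf (zi l)) (negPf (zx l)).
Qed.

Let sg := (swap_all i x * p)%g.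

Lemma unfix_val l : sg (x l) = i l /\ sg (i l) = p (x l).
Proof.
have [_ _ pi _ _] := fix_choicesP.
by have [h1 h2] := swap_all_val l; rewrite !permM h1 h2 pi.
Qed.

Lemma unfix_expansion : f p = f sg + \sum_l (f (tperm (i l) (x l) * sg)%g - f sg)
  + \sum_(w <- pairs (enum 'I_k)) swap_diff sg ((i w.1, x w.1), (i w.2, x w.2)).
Proof.
have -> : p = (swap_all i x * sg)%g by rewrite mulgA swapsK ?mul1g //; exact: uniq_swap_seq.
rewrite {1}/swap_all swaps_expansion; last exact: uniq_swap_seq.
rewrite {1}/swap_seq big_map big_enum /= /swap_seq pairs_map big_map.
by [].
Qed.

(** Applying the single transposition [l] again restores no other fixed point than [i l], which can
    thus be read off from the resulting permutation. *)
Lemma partial_unfix_fix l z : (tperm (i l) (x l) * sg)%g z = z -> z = i l.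
Proof.
have [inji injx pi px pz] := fix_choicesP.
rewrite permM; case: tpermP => [->|->|zi zx] //.
  by have [_ ->] := unfix_val l => e; have := px l; rewrite e eqxx.
have [/existsP[m /eqP zm]|] := boolP [exists m, z == i m].
  rewrite zm; have [_ ->] := unfix_val m => e.
  by have := px m; rewrite -(pi m) in e; rewrite (perm_inj e) pi eqxx.
rewrite negb_exists => /forallP zi'.
have [/existsP[m /eqP zm]|] := boolP [exists m, z == x m].
  rewrite zm; have [-> _] := unfix_val m => e.
  by have := fix_choices_neq m m; rewrite e eqxx.
rewrite negb_exists => /forallP zx'.
rewrite permM swap_all_out // => /pz[m zm].
by have := zi' m; rewrite zm eqxx.
Qed.

Lemma partial_unfix_val l : (tperm (i l) (x l) * sg)%g (i l) = i l.
Proof. by rewrite permM tpermL; have [-> _] := unfix_val l. Qed.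

End Choice.
End Unfixing.
End Expansion.

Lemma sum_le_inj (R : realFieldType) (A B : finType) (X : {set A}) (g : A -> B) (F : B -> R) :
  {in X &, injective g} -> (forall b, 0 <= F b) -> \sum_(a in X) F (g a) <= \sum_b F b.
Proof.
move=> injg F0; rewrite -(big_imset F injg) /= [leRHS](bigID (mem (g @: X))) /=.
by rewrite lerDl sumr_ge0.
Qed.

Section UnfixSums.
Variables (R : realFieldType) (T : finType) (c : T -> T -> T -> T -> R).
Variables (f : {perm T} -> R) (k0 : R).
Hypothesis f_quad : forall s, f s = quad_sum c s + k0.
Local Notation n := #|T|.
Variables (k : nat) (S : {set {perm T}}).
Hypothesis Sk : S \subset perm_class T k.

Definition unfixings : {set {perm T} * ({ffun 'I_k -> T} * {ffun 'I_k -> T})} :=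
  [set w | (w.1 \in S) && (w.2 \in fix_choices k w.1)].

Definition unfix (w : {perm T} * ({ffun 'I_k -> T} * {ffun 'I_k -> T})) :=
  (swap_all w.2.1 w.2.2 * w.1)%g.

Lemma unfixingsP p i x : (p, (i, x)) \in unfixings ->
  p \in perm_class T k /\ (i, x) \in fix_choices k p.
Proof. by rewrite in_set => /andP[/(subsetP Sk)]. Qed.

Lemma sum_unfixings (F : {perm T} -> R) :
  \sum_(w in unfixings) F w.1 = (k`! * (n - k) ^_ k)%:R * \sum_(p in S) F p.
Proof.
rewrite mulr_sumr (eq_bigl (fun w : {perm T} * ({ffun 'I_k -> T} * {ffun 'I_k -> T}) =>
  (w.1 \in S) && (w.2 \in fix_choices k w.1))); last by move=> w; rewrite in_set.
rewrite -(pair_big_dep [in S] (fun p => [in fix_choices k p]) (fun p _ => F p)) /=.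
apply: eq_bigr => p /(subsetP Sk) pk.
by rewrite sumr_const card_fix_choices // mulr_natl.
Qed.

(** Given [i], the unfixed permutation determines each [x l] as the preimage of [i l], and then
    [p]. *)
Lemma unfix_inj p i x p' x' : (p, (i, x)) \in unfixings -> (p', (i, x')) \in unfixings ->
  unfix (p, (i, x)) = unfix (p', (i, x')) -> (p, (i, x)) = (p', (i, x')).
Proof.
move=> /unfixingsP[pk ix] /unfixingsP[p'k ix'] e.
have ex : x = x'.
  apply/ffunP => l; apply: (@perm_inj _ (unfix (p, (i, x)))); rewrite [in RHS]e.
  by have [-> _] := unfix_val pk ix l; have [-> _] := unfix_val p'k ix' l.
by move: e; rewrite ex /unfix /= => /mulgI->.
Qed.

Lemma sum_ffun_const (F : {perm T} -> R) :
  \sum_(b : {perm T} * {ffun 'I_k -> T}) F b.1 = n%:R ^+ k * \sum_s F s.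
Proof.
rewrite -(pair_bigA _ (fun s _ => F s)) /= mulr_sumr; apply: eq_bigr => s _.
by rewrite sumr_const card_ffun card_ord -natrX mulr_natl.
Qed.

Lemma sum_unfix_all : \sum_(w in unfixings) `|f (unfix w)| <= n%:R ^+ k * \sum_s `|f s|.
Proof.
rewrite -(sum_ffun_const (fun s => `|f s|)).
apply: (sum_le_inj (g := fun w => (unfix w, w.2.1)) (F := fun b => `|f b.1|)) => //.
move=> [p [i x]] [p' [i' x']] wW w'W [+ ei]; rewrite /= -ei in w'W *.
exact: unfix_inj.
Qed.

(** Slot [l] of the auxiliary function stores [x l], since [i l] is recovered as the only fixed
    point. The multiplicity therefore stays at [n ^ k]. *)
Lemma sum_unfix_but_one l :
  \sum_(w in unfixings) `|f (tperm (w.2.1 l) (w.2.2 l) * unfix w)%g|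
    <= n%:R ^+ k * \sum_s `|f s|.
Proof.
rewrite -(sum_ffun_const (fun s => `|f s|)).
pose g (w : {perm T} * ({ffun 'I_k -> T} * {ffun 'I_k -> T})) :=
  ((tperm (w.2.1 l) (w.2.2 l) * unfix w)%g,
   [ffun m => if m == l then w.2.2 l else w.2.1 m]).
apply: (sum_le_inj (g := g) (F := fun b => `|f b.1|)) => //.
move=> [p [i x]] [p' [i' x']] wW w'W [es ef].
have [pk ix] := unfixingsP wW; have [p'k ix'] := unfixingsP w'W.
have fE m : (if m == l then x l else i m) = (if m == l then x' l else i' m).
  by have := congr1 (fun h : {ffun 'I_k -> T} => h m) ef; rewrite !ffunE.
have xl : x l = x' l by have := fE l; rewrite eqxx.
have il : i l = i' l.
  by apply: (partial_unfix_fix p'k ix'); rewrite -[LHS]/((_ * unfix (p', (i', x')))%g (i l)) -es; exact: (partial_unfix_val pk ix).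
have ii : i = i'.
  by apply/ffunP => m; have := fE m; case: eqVneq => [->|].
rewrite /= in es; rewrite il xl in es; rewrite ii in wW es *.
by apply: unfix_inj => //; apply: mulgI es.
Qed.

Variables (h Dm : R) (Bad : {set {perm T} * (T * T)}).
Hypothesis Dm_ge0 : 0 <= Dm.
Hypothesis Bad_le : forall p i x, (p, (i, x)) \in unfixings -> forall l m, l != m ->
  swap_diff c (unfix (p, (i, x))) ((i l, x l), (i m, x m))
    <= h + Dm * ((unfix (p, (i, x)), (i l, i m)) \in Bad)%:R.

(** The bad configuration already records [i l] and [i m], so these two slots of [i] are free to
    carry an arbitrary pair of points. This saves the factor [n ^ 2]. *)
Lemma card_bad_unfixings l m : l != m ->
  (#|[set w in unfixings | (unfix w, (w.2.1 l, w.2.1 m)) \in Bad]| * n ^ 2 <= #|Bad| * n ^ k)%N.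
Proof.
move=> lm; set B := [set w in _ | _].
have <- : #|{: T * T}| = (n ^ 2)%N by rewrite card_prod.
have <- : #|{: {ffun 'I_k -> T}}| = (n ^ k)%N by rewrite card_ffun card_ord.
rewrite -cardsT -[#|{: {ffun _ -> _}}|]cardsT -!cardsX.
pose g (z : ({perm T} * ({ffun 'I_k -> T} * {ffun 'I_k -> T})) * (T * T)) :=
  ((unfix z.1, (z.1.2.1 l, z.1.2.1 m)),
   [ffun r => if r == l then z.2.1 else if r == m then z.2.2 else z.1.2.1 r]).
have BW w : w \in B -> w \in unfixings by rewrite in_set => /andP[].
have ginj : {in setX B [set: T * T] &, injective g}.
  move=> [[p [i x]] [a b]] [[p' [i' x']] [a' b']]; rewrite !in_setX !in_setT !andbT.
  move=> /BW wW /BW w'W [es il im ef].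
  have fE r : (if r == l then a else if r == m then b else i r) =
      (if r == l then a' else if r == m then b' else i' r).
    by have := congr1 (fun F : {ffun 'I_k -> T} => F r) ef; rewrite !ffunE.
  have <- : a = a' by have := fE l; rewrite eqxx.
  have <- : b = b' by have := fE m; rewrite eqxx eq_sym (negPf lm).
  have ii : i = i'.
    by apply/ffunP => r; have := fE r; case: eqVneq => [->//|_]; case: eqVneq => [->|].
  by congr (_, _); rewrite -ii in w'W es *; exact: unfix_inj es.
rewrite -(card_in_imset ginj); apply: subset_leq_card.
apply/subsetP => _ /imsetP[[w z] + ->]; rewrite !in_setX !in_setT !andbT in_set.
by case/andP.
Qed.

Lemma sum_swap_diff_le l m : l != m ->
  (\sum_(w in unfixings) swap_diff c (unfix w) ((w.2.1 l, w.2.2 l), (w.2.1 m, w.2.2 m))) * n%:R ^+ 2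
   <= h * (k`! * (n - k) ^_ k)%:R * #|S|%:R * n%:R ^+ 2 + Dm * (#|Bad|%:R * n%:R ^+ k).
Proof.
move=> lm; pose B := [set w in unfixings | (unfix w, (w.2.1 l, w.2.1 m)) \in Bad].
apply: (@le_trans _ _ ((\sum_(w in unfixings) (h + Dm *
    ((unfix w, (w.2.1 l, w.2.1 m)) \in Bad)%:R)) * n%:R ^+ 2)).
  rewrite ler_wpM2r ?exprn_ge0 //; apply: ler_sum => -[p [i x]] wW.
  exact: Bad_le.
rewrite big_split /= (sum_unfixings (fun=> h)) sumr_const -mulr_sumr mulrDl.
have -> : \sum_(w in unfixings) ((unfix w, (w.2.1 l, w.2.1 m)) \in Bad)%:R = #|B|%:R :> R.
  rewrite -sum1_card natr_sum big_mkcond [RHS]big_mkcond; apply: eq_bigr => w _.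
  rewrite [w \in B]in_set; case: (w \in unfixings) => //.
  by case: (_ \in Bad).
apply: lerD.
  by rewrite -[h *+ _]mulr_natr; rewrite le_eqVlt; apply/orP; left; apply/eqP; ring.
rewrite -mulrA ler_wpM2l // -!natrX -!natrM ler_nat.
exact: card_bad_unfixings.
Qed.

(** In the expansion, [f] at the unfixed permutation has total coefficient [1 - k], and there are
    [k] further first-order terms; together they cost [2 * k] times the L1 norm. Each pair costs
    [h], plus [Dm] on a bad configuration. *)
Lemma sum_class_le : (0 < k)%N ->
  (k`! * (n - k) ^_ k)%:R * (\sum_(p in S) f p) * n%:R ^+ 2 <=
    (2 * k)%:R * n%:R ^+ k * n%:R ^+ 2 * (\sum_s `|f s|) +
    'C(k, 2)%:R * (h * (k`! * (n - k) ^_ k)%:R * #|S|%:R * n%:R ^+ 2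
      + Dm * (#|Bad|%:R * n%:R ^+ k)).
Proof.
move=> k0'; rewrite -sum_unfixings.
pose D (w : {perm T} * ({ffun 'I_k -> T} * {ffun 'I_k -> T})) (l m : 'I_k) := swap_diff c (unfix w) ((w.2.1 l, w.2.2 l), (w.2.1 m, w.2.2 m)).
pose tau (w : {perm T} * ({ffun 'I_k -> T} * {ffun 'I_k -> T})) (l : 'I_k) := (tperm (w.2.1 l) (w.2.2 l) * unfix w)%g.
have -> : \sum_(w in unfixings) f w.1 = \sum_(w in unfixings)
    (f (unfix w) + \sum_l (f (tau w l) - f (unfix w)))
    + \sum_(z <- pairs (enum 'I_k)) \sum_(w in unfixings) D w z.1 z.2.
  rewrite exchange_big -big_split /=; apply: eq_bigr => -[p [i x]] wW.
  by have [pk ix] := unfixingsP wW; rewrite (unfix_expansion f_quad pk ix).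
rewrite mulrDl; apply: lerD.
  rewrite mulrAC; apply: ler_wpM2r; first by rewrite exprn_ge0.
  apply: (@le_trans _ _ (\sum_(w in unfixings)
      (k%:R * `|f (unfix w)| + \sum_l `|f (tau w l)|))).
    apply: ler_sum => w _; rewrite big_split /= sumrN sumr_const card_ord.
    have h1 : \sum_l f (tau w l) <= \sum_l `|f (tau w l)|.
      by apply: ler_sum => l _; exact: ler_norm.
    suff : f (unfix w) - f (unfix w) *+ k <= k%:R * `|f (unfix w)| by lra.
    case: (k) k0' => [//|j] _.
    rewrite mulrS opprD addrA subrr add0r -mulr_natl.
    have := ler_norm (- f (unfix w)); rewrite normrN => h2.
    have : j%:R * - f (unfix w) <= j%:R * `|f (unfix w)| by rewrite ler_wpM2l.
    have := normr_ge0 (f (unfix w)); rewrite -[j.+1%:R]natr1; lra.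
  rewrite big_split /= -mulr_sumr exchange_big /=.
  have h1 : k%:R * \sum_(w in unfixings) `|f (unfix w)| <= k%:R * (n%:R ^+ k * \sum_s `|f s|).
    by rewrite ler_wpM2l // sum_unfix_all.
  have h2 : \sum_l \sum_(w in unfixings) `|f (tau w l)| <= k%:R * (n%:R ^+ k * \sum_s `|f s|).
    have -> : k%:R * (n%:R ^+ k * \sum_s `|f s|) = \sum_(l < k) (n%:R ^+ k * \sum_s `|f s|) :> R.
      by rewrite sumr_const card_ord mulr_natl.
    by apply: ler_sum => l _; exact: sum_unfix_but_one.
  by rewrite natrM; lra.
set X := (X in _ <= _ * X).
have -> : 'C(k, 2)%:R * X = \sum_(z <- pairs (enum 'I_k)) X.
  by rewrite big_const_seq iter_addr_0 count_predT size_pairs size_enum_ord mulr_natl.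
rewrite mulr_suml big_seq [leRHS]big_seq; apply: ler_sum => z.
by move=> /(pairs_neq (enum_uniq _)); exact: sum_swap_diff_le.
Qed.

End UnfixSums.

(** * Configurations with a large second difference *)

Section BadConfigurations.
Variables (R : realFieldType) (T : finType) (c : T -> T -> T -> T -> R).
Variables (f : {perm T} -> R) (k0 : R).
Hypothesis f_quad : forall s, f s = quad_sum c s + k0.
Local Notation n := #|T|.
Variables (kappa lam : R).
Hypotheses (n_ge : (24 <= n)%N) (kappa_gt0 : 0 < kappa).
Hypothesis heavy_le : #|heavy f kappa|%:R * n%:R ^+ 2 <= lam * (n`!)%:R.
Variable M : T -> T -> T -> T -> R.
Hypothesis M_val : coset_values c f kappa lam M.
Hypotheses (n_big : 16 * (12 * lam + 18) < n%:R) (n_big' : 2 * (28 * lam + 36) <= n%:R).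

Lemma full_coset a b e d eta : a != e -> b != d -> 28 * lam + 36 <= eta * n%:R ->
  19 * kappa <= M a b e d ->
  (1 - eta) * ((n - 2)`!)%:R <= #|[set s | 10 * kappa <= f s]|%:R.
Proof.
move=> ae bd h_eta hM.
apply: le_trans (coset_value_near n_ge M_val ae bd (P := fun s => 10 * kappa <= f s) h_eta _) _.
  by move=> s _; rewrite ler_norml => /andP[h _]; lra.
by rewrite ler_nat subset_leq_card //; apply/subsetP => s; rewrite !in_set => /andP[].
Qed.

(** A value of at most [-19 kappa] makes [f] at most [-10 kappa] on at least half of the coset,
    which is then heavy. *)
Lemma value_gt_of_not_heavy w : w.1.1 != w.2.1 -> w.1.2 != w.2.2 ->
  w \notin heavy_cosets f kappa -> - (19 * kappa) < M w.1.1 w.1.2 w.2.1 w.2.2.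
Proof.
move=> ae bd; rewrite ltNge; apply: contra => hM; rewrite in_set ae bd /=.
have : (1 - 1 / 2) * ((n - 2)`!)%:R <=
    #|[set s in coset2 w.1.1 w.1.2 w.2.1 w.2.2 | kappa < `|f s|]|%:R :> R.
  have hh : 28 * lam + 36 <= 1 / 2 * n%:R by have := n_big'; lra.
  apply: (coset_value_near n_ge M_val ae bd hh) => s _.
  rewrite ler_norml => /andP[_ h].
  by rewrite -normrN; apply: lt_le_trans (ler_norm _); have := kappa_gt0; lra.
rewrite (_ : [set s in _ | _] = heavy f kappa :&: coset2 w.1.1 w.1.2 w.2.1 w.2.2).
  move=> h; rewrite -(ler_nat R) natrM; lra.
by apply/setP => s; rewrite in_setI !in_set andbC.
Qed.

Definition bad_configs h := [set z : {perm T} * (T * T) |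
  uniq [:: z.2.1; (z.1^-1)%g z.2.1; z.2.2; (z.1^-1)%g z.2.2] &&
  (h < swap_diff c z.1 ((z.2.1, (z.1^-1)%g z.2.1), (z.2.2, (z.1^-1)%g z.2.2)))].

(* [Pp] and [Np] list the cosets (position, value) that enter [swap_diff] with sign
   [+] and [-]. The product of a [Pp] and an [Np] entry is negative, and at least one
   of its two constraints pins down a value of [s]. *)
Let Pp (a : bool) (s : {perm T}) x := if a then (x, s x) else ((s^-1)%g x, x).
Let Np (a : bool) (s : {perm T}) x := if a then (x, x) else ((s^-1)%g x, s x).

Let fiber_le (B : {set {perm T} * (T * T)}) u v (G : {perm T} -> T * T) :
  (forall z, z \in B -> z.1 u = v /\ z.2 = G z.1) -> (#|B| <= (n - 1)`!)%N.
Proof.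
move=> BP; have := @card_perm_seq T [:: u] [:: v] isT isT erefl => /= <-.
apply: leq_trans (leq_imset_card (fun s => (s, G s)) _); apply: subset_leq_card.
apply/subsetP => -[s z] /BP[/= su ->]; apply/imsetP; exists s => //.
by rewrite in_set su.
Qed.

Let B1 a b := [set z : {perm T} * (T * T) |
  (Pp a z.1 z.2.1, Np b z.1 z.2.2) \in heavy_cosets f kappa].
Let B2 a b := [set z : {perm T} * (T * T) |
  (Np b z.1 z.2.1, Pp a z.1 z.2.2) \in heavy_cosets f kappa].

Let PpP a s x w : Pp a s x = w -> s w.1 = w.2 /\ x = if a then w.1 else w.2.
Proof. by rewrite /Pp => <-; case: a => //=; rewrite permKV. Qed.

Let NpP a s x w : Np a s x = w -> x = if a then w.1 else s w.1.
Proof. by rewrite /Np => <-; case: a => //=; rewrite permKV. Qed.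

Let card_B1 a b : (#|B1 a b| <= #|heavy_cosets f kappa| * (n - 1)`!)%N.
Proof.
apply: (card_partition_le (h := fun z => (Pp a z.1 z.2.1, Np b z.1 z.2.2))).
  by move=> z; rewrite in_set.
move=> w _; apply: (fiber_le (u := w.1.1) (v := w.1.2)
  (G := fun s => (if a then w.1.1 else w.1.2, if b then w.2.1 else s w.2.1))) => -[s [x y]].
rewrite in_set => /andP[_ /eqP[]]; rewrite [w]surjective_pairing => -[/PpP[-> hx] /NpP hy].
by split=> //=; rewrite -hx -hy.
Qed.

Let card_B2 a b : (#|B2 a b| <= #|heavy_cosets f kappa| * (n - 1)`!)%N.
Proof.
apply: (card_partition_le (h := fun z => (Np b z.1 z.2.1, Pp a z.1 z.2.2))).
  by move=> z; rewrite in_set.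
move=> w _; apply: (fiber_le (u := w.2.1) (v := w.2.2)
  (G := fun s => (if b then w.1.1 else s w.1.1, if a then w.2.1 else w.2.2))) => -[s [x y]].
rewrite in_set => /andP[_ /eqP[]]; rewrite [w]surjective_pairing => -[/NpP hy /PpP[-> hx]].
by split=> //=; rewrite -hx -hy.
Qed.

Section Config.
Variables (s : {perm T}) (x y : T).
Hypothesis u : uniq [:: x; (s^-1)%g x; y; (s^-1)%g y].

Let rows_cols : [/\ x != y, x != (s^-1)%g y, (s^-1)%g x != y & (s^-1)%g x != (s^-1)%g y] /\
  [/\ s x != s y, s x != y, x != s y & x != y].
Proof.
move: u; rewrite /= !inE !negb_or.
case/and4P=> /and3P[_ xy xq] /andP[py pq] _ _; split=> //.
split=> //; first by rewrite (inj_eq perm_inj).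
  by apply: contraNneq xq => e; rewrite -e permK.
by apply: contraNneq py => ->; rewrite permK.
Qed.

Let approx :
  `|swap_diff c s ((x, (s^-1)%g x), (y, (s^-1)%g y))
    - cross (fun z k => cross (M z k) y ((s^-1)%g y) (s y) y) x ((s^-1)%g x) (s x) x|
  <= 96 * kappa.
Proof.
have [hr hc] := rows_cols; rewrite /swap_diff /= !permKV.
by apply: (second_diff_approx n_ge M_val).
Qed.

Lemma config_bound L : (\sum_s `|f s|) * n%:R ^+ 2 <= L * (n`!)%:R ->
  swap_diff c s ((x, (s^-1)%g x), (y, (s^-1)%g y)) <= 16 * (2 * L + 9 * kappa) + 96 * kappa.
Proof.
move=> hL; move: approx; rewrite ler_norml => /andP[_].
have b a1 b1 a2 b2 : a1 != a2 -> b1 != b2 ->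
    - (2 * L + 9 * kappa) <= M a1 b1 a2 b2 <= 2 * L + 9 * kappa.
  move=> ha hb; rewrite -ler_norml.
  exact: (coset_value_bound n_ge M_val ha hb (ltW kappa_gt0) n_big' hL).
have [[r1 r2 r3 r4] [c1 c2 c3 c4]] := rows_cols.
have /andP[? ?] := b _ _ _ _ r1 c1; have /andP[? ?] := b _ _ _ _ r1 c2.
have /andP[? ?] := b _ _ _ _ r1 c3; have /andP[? ?] := b _ _ _ _ r1 c4.
have /andP[? ?] := b _ _ _ _ r2 c1; have /andP[? ?] := b _ _ _ _ r2 c2.
have /andP[? ?] := b _ _ _ _ r2 c3; have /andP[? ?] := b _ _ _ _ r2 c4.
have /andP[? ?] := b _ _ _ _ r3 c1; have /andP[? ?] := b _ _ _ _ r3 c2.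
have /andP[? ?] := b _ _ _ _ r3 c3; have /andP[? ?] := b _ _ _ _ r3 c4.
have /andP[? ?] := b _ _ _ _ r4 c1; have /andP[? ?] := b _ _ _ _ r4 c2.
have /andP[? ?] := b _ _ _ _ r4 c3; have /andP[? ?] := b _ _ _ _ r4 c4.
by rewrite /cross; lra.
Qed.

Hypothesis no_full : forall a b e d, a != e -> b != d -> M a b e d < 19 * kappa.

(** If no product of a [Pp] and an [Np] entry were heavy, each of the sixteen signed values would be
    below [19 kappa]; with the error [96 kappa] this gives at most [400 kappa]. *)
Lemma bad_config_heavy :
  400 * kappa < swap_diff c s ((x, (s^-1)%g x), (y, (s^-1)%g y)) ->
  exists a b, (s, (x, y)) \in B1 a b :|: B2 a b.
Proof.
move=> hD.
have [/existsP[a /existsP[b h]]|nex] := boolP [exists a, exists b, (s, (x, y)) \in B1 a b :|: B2 a b].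
  by exists a, b.
have nB a b : ((Pp a s x, Np b s y) \notin heavy_cosets f kappa) /\
    ((Np b s x, Pp a s y) \notin heavy_cosets f kappa).
  move: nex; rewrite negb_exists => /forallP/(_ a); rewrite negb_exists => /forallP/(_ b).
  by rewrite in_setU negb_or ![(s, _) \in _]in_set => /andP[].
have [[r1 r2 r3 r4] [c1 c2 c3 c4]] := rows_cols.
have g a1 b1 a2 b2 : a1 != a2 -> b1 != b2 ->
    ((a1, b1), (a2, b2)) \notin heavy_cosets f kappa -> - (19 * kappa) < M a1 b1 a2 b2.
  exact: (@value_gt_of_not_heavy ((a1, b1), (a2, b2))).
have [tt1 tt2] := nB true true; have [tf1 tf2] := nB true false.
have [ft1 ft2] := nB false true; have [ff1 ff2] := nB false false.
have m1 := g _ _ _ _ r1 c2 tt1; have m2 := g _ _ _ _ r1 c3 tt2.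
have m3 := g _ _ _ _ r2 c1 tf1; have m4 := g _ _ _ _ r3 c1 tf2.
have m5 := g _ _ _ _ r3 c4 ft1; have m6 := g _ _ _ _ r2 c4 ft2.
have m7 := g _ _ _ _ r4 c3 ff1; have m8 := g _ _ _ _ r4 c2 ff2.
have p1 := no_full r1 c1; have p2 := no_full r2 c2.
have p3 := no_full r3 c3; have p4 := no_full r4 c4.
have p5 := no_full r1 c4; have p6 := no_full r2 c3.
have p7 := no_full r3 c2; have p8 := no_full r4 c1.
clear g.
move: approx; rewrite ler_norml => /andP[_]; rewrite /cross; lra.
Qed.

End Config.

Lemma card_bad_configs h : 400 * kappa <= h ->
  (forall a b e d, a != e -> b != d -> M a b e d < 19 * kappa) ->
  (#|bad_configs h| <= 8 * (#|heavy_cosets f kappa| * (n - 1)`!))%N.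
Proof.
move=> hk no_full; pose F (i : bool * bool) := B1 i.1 i.2 :|: B2 i.1 i.2.
have sub : bad_configs h \subset \bigcup_i F i.
  apply/subsetP => -[s [x y]]; rewrite in_set => /andP[us hD].
  have [a [b hab]] := bad_config_heavy us no_full (le_lt_trans hk hD).
  by apply/bigcupP; exists (a, b).
apply: leq_trans (subset_leq_card sub) _; apply: leq_trans (card_bigcup_le _) _.
apply: (@leq_trans (\sum_(i : bool * bool) 2 * (#|heavy_cosets f kappa| * (n - 1)`!))).
  apply: leq_sum => i _; apply: leq_trans (leq_card_setU _ _) _.
  by rewrite mul2n -addnn leq_add.
by rewrite sum_nat_const card_prod card_bool mulnA.
Qed.

End BadConfigurations.

(** * Large values of normalized objectives *)

Lemma ffact_ge_exp m j : ((m - j) ^ j <= m ^_ j)%N.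
Proof.
elim: j m => // j IHj [|m]; first by rewrite sub0n exp0n.
by rewrite ffactSS subSS expnS leq_mul // (leq_trans (leq_subr _ _)).
Qed.

Section Estimates.
Variable R : realFieldType.

Lemma bernoulli_sub (x : R) k : 0 <= x <= 1 -> 1 - k%:R * x <= (1 - x) ^+ k.
Proof.
move=> /andP[x0 x1]; elim: k => [|k IHk]; first by rewrite mul0r subr0 expr0.
rewrite exprS; apply: (@le_trans _ _ ((1 - x) * (1 - k%:R * x))); last first.
  by rewrite ler_wpM2l // subr_ge0.
have : 0 <= k%:R * x ^+ 2 by rewrite mulr_ge0 // sqr_ge0.
by rewrite -natr1; lra.
Qed.

(** By Bernoulli, [(1 - 2 * k / m) ^ k >= 1 - 2 * k ^ 2 / m >= 1 / 2]. *)
Lemma exp_le_ffact m k : (0 < m)%N -> 4 * k%:R ^+ 2 <= (m%:R : R) ->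
  (m%:R ^+ k : R) <= 2 * ((m - k) ^_ k)%:R.
Proof.
move=> m0 mk; have M0 : 0 < (m%:R : R) by rewrite ltr0n.
have km : (2 * k <= m)%N.
  move: mk; rewrite -(natrX _ k 2) -[4]/(4%:R) -natrM ler_nat; apply: leq_trans.
  by case: k => // k; rewrite -mulnn; lia.
have h : ((m - 2 * k) ^ k <= (m - k) ^_ k)%N.
  by rewrite mul2n -addnn subnDA ffact_ge_exp.
apply: (@le_trans _ _ (2 * ((m - 2 * k) ^ k)%:R)); last by rewrite ler_pM2l // ler_nat.
pose x : R := (2 * k)%:R / m%:R.
have x01 : 0 <= x <= 1 by rewrite divr_ge0 //= ler_pdivrMr // mul1r ler_nat.
have -> : ((m - 2 * k) ^ k)%:R = m%:R ^+ k * (1 - x) ^+ k :> R.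
  by rewrite natrX natrB // -exprMn; congr (_ ^+ _); rewrite /x; field; rewrite gt_eqF.
have mk0 : 0 < m%:R ^+ k :> R by rewrite exprn_gt0.
have hx : 1 / 2 <= (1 - x) ^+ k.
  apply: le_trans (bernoulli_sub k x01).
  have : k%:R * x <= 1 / 2.
    rewrite /x natrM mulrA ler_pdivrMr //; lra.
  lra.
have : m%:R ^+ k * (1 / 2) <= m%:R ^+ k * (1 - x) ^+ k by rewrite ler_pM2l.
lra.
Qed.

Section ClassMean.
Variables (T : finType) (c : T -> T -> T -> T -> R) (f : {perm T} -> R) (k0 : R).
Hypothesis f_quad : forall s, f s = quad_sum c s + k0.
Local Notation n := #|T|.
Local Notation e := ((\sum_s `|f s|) / (n`!)%:R).

(** Write the class mean as [y 0 + k * (y 1 - y 0) + h2 * k * (k - 1)]. Positive density of the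
    classes of 0 and 1 bounds the first two coefficients by [5 * e] and [10 * e], and the value 1 at
    [n] then forces [h2 >= 1 / (2 * n ^ 2)]. *)
Lemma class_mean_ge k : (4 <= n)%N -> (k + 3 <= n)%N -> f 1%g = 1 ->
  5 * e + 10 * e * n%:R <= 1 / 2 ->
  #|perm_class T k|%:R * (k%:R * (k%:R - 1) / (2 * n%:R ^+ 2) - (5 + 10 * k%:R) * e)
    <= \sum_(s in perm_class T k) f s.
Proof.
move=> n4 kn f1 he; have [h0 [h1 [h2 [hk hid]]]] := perm_class_sum c n4.
pose y j : R := h0 + k0 + h1 * j%:R + h2 * j%:R ^+ 2.
have F0 : 0 < ((n`!)%:R : R) by rewrite ltr0n fact_gt0.
have e0 : 0 <= e by rewrite divr_ge0 // sumr_ge0.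
have sumE : \sum_s `|f s| = e * (n`!)%:R by rewrite divfK // gt_eqF.
move: e e0 he sumE => E e0 he sumE.
have sumy j : \sum_(s in perm_class T j) f s = #|perm_class T j|%:R * y j.
  rewrite (eq_bigr (fun s => quad_sum c s + k0)) // big_split /= hk sumr_const.
  by rewrite -[k0 *+ _]mulr_natl /y; ring.
have yb j : (j <= 1)%N -> `|y j| <= 5 * E.
  move=> j1; have cj : (n`! <= 5 * #|perm_class T j|)%N.
    have := @card_perm_class T j; case: j j1 => [|[]] //= _; rewrite muln1; apply;
      exact: leq_trans n4.
  have C0 : 0 < (#|perm_class T j|%:R : R).
    by rewrite ltr0n; have := fact_gt0 n; lia.
  have : #|perm_class T j|%:R * `|y j| <= \sum_s `|f s|.
    rewrite -[X in X * _]ger0_norm // -normrM -sumy.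
    apply: le_trans (ler_norm_sum _ _ _) _.
    by rewrite [leRHS](bigID (mem (perm_class T j))) /= lerDl sumr_ge0.
  rewrite sumE => h; rewrite -(ler_pM2l C0); apply: le_trans h _.
  have : (n`!)%:R <= 5 * #|perm_class T j|%:R :> R by rewrite -[5]/(5%:R) -natrM ler_nat.
  move=> h; have := ler_wpM2l e0 h; lra.
have y0 : y 0%N = h0 + k0 by rewrite /y; ring.
have y1 : y 1%N = h0 + k0 + h1 + h2 by rewrite /y; ring.
have := yb 1%N isT; have := yb 0%N isT.
rewrite y0 y1 !ler_norml => /andP[a3 a4] /andP[a1 a2].
have idE : h0 + k0 + h1 * n%:R + h2 * n%:R ^+ 2 = 1 by rewrite -[RHS]f1 f_quad hid; ring.
have n0 : 4 <= (n%:R : R) by rewrite (ler_nat _ 4).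
rewrite sumy ler_wpM2l //; rewrite /y.
have N2 : 0 < n%:R ^+ 2 :> R by rewrite exprn_gt0 //; lra.
have b1 : - (10 * E) <= h1 + h2 by lra.
have b2 : h1 + h2 <= 10 * E by lra.
have b3 : n%:R * (h1 + h2) <= n%:R * (10 * E) by rewrite ler_wpM2l.
have b4 : 1 / 2 <= h2 * (n%:R ^+ 2 - n%:R) by lra.
have N2' : 0 < n%:R ^+ 2 - n%:R :> R.
  have : 4 * n%:R <= n%:R ^+ 2 :> R by rewrite expr2 ler_wpM2r.
  by lra.
have h2_ge0 : 0 <= h2 by rewrite -(pmulr_lge0 _ N2'); lra.
have h2b : 1 / (2 * n%:R ^+ 2) <= h2.
  have D0 : 0 < 2 * n%:R ^+ 2 :> R by lra.
  rewrite ler_pdivrMr //; have : 0 <= h2 * n%:R by rewrite mulr_ge0.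
  lra.
have kk : 0 <= k%:R * (k%:R - 1) :> R.
  by case: k kn => [|j] _; rewrite ?mul0r // -natr1 addrK mulr_ge0 // addr_ge0.
have b5 := ler_wpM2l kk h2b.
have b6 : k%:R * - (10 * E) <= k%:R * (h1 + h2) by rewrite ler_wpM2l.
have -> : k%:R * (k%:R - 1) / (2 * n%:R ^+ 2) = k%:R * (k%:R - 1) * (1 / (2 * n%:R ^+ 2)) :> R.
  by rewrite mul1r.
lra.
Qed.

End ClassMean.

End Estimates.

Lemma card_permT (T : finType) : #|{: {perm T}}| = #|T|`!.
Proof.
have := @card_perm_seq T [::] [::] isT isT erefl; rewrite subn0 => <-.
by apply: eq_card => s; rewrite !inE.
Qed.

(* The one-sided bound [f <= 1] controls the whole L1 norm, the mean being 0. *)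
Lemma l1_norm_le (R : realFieldType) (T : finType) (f : {perm T} -> R) t : 0 <= t ->
  \sum_s f s = 0 -> (forall s, f s <= 1) ->
  \sum_s `|f s| <= 2 * (t * (#|T|`!)%:R + #|[set s | t <= f s]|%:R).
Proof.
move=> t0 f0 f1; have -> : \sum_s `|f s| = \sum_s (`|f s| + f s) by rewrite big_split /= f0 addr0.
have -> : (#|T|`!)%:R = \sum_(s : {perm T}) 1 :> R.
  by rewrite sumr_const card_permT.
rewrite -sum1_card natr_sum [X in _ + X]big_mkcond /= mulr_sumr -big_split /= mulr_sumr.
apply: ler_sum => s _; rewrite in_set; case: (leP t (f s)) => h.
  by have := f1 s; rewrite ger0_norm ?(le_trans t0) //; lra.
have [fs|fs] := leP 0 (f s); first by rewrite ger0_norm //; lra.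
by rewrite ltr0_norm //; lra.
Qed.

(* The long hypothesis is the conclusion of [sum_class_le], with [q = N ^+ k] and
   [kf = k`!]. *)
Lemma class_part_arith (R : realFieldType) (v SS N A F q kf k C2 h s Dm bad lam C L : R) :
  0 < v -> 0 < N -> 0 <= q -> 0 <= k -> 0 <= L -> 0 <= C2 -> 0 <= h -> 0 <= Dm -> 0 <= lam ->
  0 <= C ->
  v * SS * N ^+ 2 <= 2 * k * q * N ^+ 2 * A + C2 * (h * v * s * N ^+ 2 + Dm * (bad * q)) ->
  q * kf <= 2 * v -> A * N ^+ 2 <= L * F -> s * N ^+ 2 <= F -> bad * N <= 128 * lam * F ->
  F <= 5 * kf * C -> h * (5 * kf * C2) = 1 -> 1280 * C2 * Dm * lam <= N ->
  SS * N ^+ 2 <= (20 * k * L + 2) * C.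
Proof.
move=> v0 N0 q0 k_ge0 L0 C20 h0 Dm0 lam0 C0 hS hq hA hs hbad hF hh hN.
have qF : q * F <= 10 * v * C.
  have : q * F <= q * (5 * kf * C) by rewrite ler_wpM2l.
  have : 5 * C * (q * kf) <= 5 * C * (2 * v) by rewrite ler_wpM2l // mulr_ge0.
  lra.
have t1 : 2 * k * q * N ^+ 2 * A <= 20 * k * L * v * C.
  have : 2 * k * q * (A * N ^+ 2) <= 2 * k * q * (L * F) by rewrite ler_wpM2l // !mulr_ge0.
  have : 2 * k * L * (q * F) <= 2 * k * L * (10 * v * C) by rewrite ler_wpM2l // !mulr_ge0.
  lra.
have t2 : C2 * (h * v * s * N ^+ 2) <= v * C.
  have : C2 * h * v * (s * N ^+ 2) <= C2 * h * v * F by rewrite ler_wpM2l // !mulr_ge0 // ltW.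
  have : C2 * h * v * F <= C2 * h * v * (5 * kf * C) by rewrite ler_wpM2l // !mulr_ge0 // ltW.
  have -> : C2 * h * v * (5 * kf * C) = h * (5 * kf * C2) * (v * C) by ring.
  by rewrite hh; lra.
have t3 : C2 * (Dm * (bad * q)) <= v * C.
  rewrite -(ler_pM2l N0).
  have : C2 * Dm * q * (bad * N) <= C2 * Dm * q * (128 * lam * F) by rewrite ler_wpM2l // !mulr_ge0.
  have : 128 * C2 * Dm * lam * (q * F) <= 128 * C2 * Dm * lam * (10 * v * C).
    by rewrite ler_wpM2l // !mulr_ge0.
  have : v * C * (1280 * C2 * Dm * lam) <= v * C * N by rewrite ler_wpM2l // mulr_ge0 // ltW.
  lra.
by rewrite -(ler_pM2l v0); lra.
Qed.

(** [L] bounds [n ^ 2] times the mean of [|f|], and [lam = L / kappa] comes from Markov's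
    inequality. The choice of [h] makes all pairs together contribute at most the class size over
    [n ^ 2]. Finally [k >= 80 * L + 1] makes [k * (k - 1) / 2] at least [40 * k * L], which beats
    the losses [10 * k * L] and [20 * k * L] and the bounded terms. *)
Lemma sharp_large_values_aux (R : realFieldType) (T : finType) (c : T -> T -> T -> T -> R)
    (f : {perm T} -> R) (k0 alpha eps L kappa lam h Dm : R) (k : nat) :
  (forall s, f s = quad_sum c s + k0) -> \sum_s f s = 0 ->
  (forall s, f s <= 1) -> f 1%g = 1 ->
  0 < alpha -> 0 < eps -> L = 2 * (alpha + 1) -> 80 * L + 1 <= k%:R ->
  0 < kappa -> 0 < lam -> lam * kappa = L -> 400 * kappa = h ->
  h * (5 * (k`!)%:R * 'C(k, 2)%:R) = 1 -> Dm = 16 * (2 * L + 9 * kappa) + 96 * kappa ->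
  24 <= (#|T|%:R : R) -> 30 * L <= #|T|%:R -> 16 * (12 * lam + 18) < #|T|%:R ->
  2 * (28 * lam + 36) <= #|T|%:R -> 28 * lam + 36 <= eps * #|T|%:R ->
  alpha <= 10 * kappa * #|T|%:R -> 4 * (k%:R : R) ^+ 2 <= #|T|%:R ->
  1280 * 'C(k, 2)%:R * Dm * lam <= #|T|%:R -> k%:R + 3 <= (#|T|%:R : R) ->
  16 * lam + 2 <= #|T|%:R ->
  (1 - eps) * (#|T|`!)%:R <=
    #|[set s | alpha / #|T|%:R ^+ 2 <= f s]|%:R * #|T|%:R ^+ 2.
Proof.
move=> f_quad f_sum f_le f_id alpha_gt0 eps_gt0 LE k_ge kappa_gt0 lam_gt0 lamE hE.
move=> C2E DmE n24 n1 n2 n3 n4 n5 n6 n7 n8 n9.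
have nn : (24 <= #|T|)%N by rewrite -(ler_nat R).
have kn : (k + 3 <= #|T|)%N by rewrite -(ler_nat R) natrD.
have L_ge : 2 <= L by lra.
have k_ge2 : 161 <= (k%:R : R) by lra.
have k_gt0 : (0 < k)%N by rewrite -(ltr_nat R); lra.
rewrite leNgt; apply/negP; set E := [set s | _]; move=> hE0.
set N : R := #|T|%:R in n24 n1 n2 n3 n4 n5 n6 n7 n8 n9 E hE0 *.
have N0 : 0 < N by lra.
have N2 : 0 < N ^+ 2 by rewrite exprn_gt0.
set F : R := (#|T|`!)%:R in hE0 *; have F0 : 0 < F by rewrite ltr0n fact_gt0.
have hE1 : #|E|%:R * N ^+ 2 <= F.
  by have h0 := mulr_gt0 eps_gt0 F0; clear -h0 hE0; lra.
set A := \sum_s `|f s|.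
have hA : A * N ^+ 2 <= L * F.
  have := l1_norm_le (divr_ge0 (ltW alpha_gt0) (ltW N2)) f_sum f_le; rewrite -/E -/F -/A => h1.
  have h2 : A * N ^+ 2 <= 2 * (alpha / N ^+ 2 * F + #|E|%:R) * N ^+ 2 by rewrite ler_pM2r.
  have h3 : alpha / N ^+ 2 * F * N ^+ 2 = alpha * F by field; rewrite gt_eqF.
  by rewrite LE; clear -h1 h2 h3 hE1; lra.
have A0 : 0 <= A by rewrite sumr_ge0.
have hheavy : #|heavy f kappa|%:R * N ^+ 2 <= lam * F.
  have h1 : kappa * #|heavy f kappa|%:R <= A.
    rewrite mulr_natr -sumr_const /A [leRHS](bigID (mem (heavy f kappa))) /= ler_wpDr ?sumr_ge0 //.
    by apply: ler_sum => s; rewrite in_set => /ltW.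
  rewrite -(ler_pM2l kappa_gt0) [leRHS]mulrA [kappa * lam]mulrC lamE [leLHS]mulrA.
  by apply: le_trans hA; rewrite ler_wpM2r // ltW.
have [M M_val] := exists_coset_values f_quad nn hheavy.
(* Such a coset alone would contain [(1 - eps) * (n - 2)!] elements of [E], more than [hE0] allows.
   For [eps > 1] the right side of [hE0] is negative, which is absurd at once. *)
have no_full a b e d : a != e -> b != d -> M a b e d < 19 * kappa.
  move=> ae bd; rewrite ltNge; apply/negP => hM.
  have h1 := full_coset nn M_val ae bd n4 hM.
  have h2 : #|[set s | 10 * kappa <= f s]|%:R <= #|E|%:R :> R.
    rewrite ler_nat subset_leq_card //; apply/subsetP => s; rewrite !in_set; apply: le_trans.
    rewrite ler_pdivrMr //; apply: le_trans n5 _; rewrite expr2 mulrA ler_peMr //; last by clear -n24; lra.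
    by rewrite !mulr_ge0 ?ltW.
  have h3 : F <= N ^+ 2 * ((#|T| - 2)`!)%:R.
    rewrite -natrX -natrM ler_nat fact_pred2 ?(leq_trans _ nn) // leq_mul2r.
    by apply/orP; right; rewrite -mulnn leq_mul2l leq_subr orbT.
  have [eps1|eps1] := leP eps 1; last first.
    have e0 : 0 <= #|E|%:R * N ^+ 2 by rewrite mulr_ge0 // ltW.
    have e1 : (1 - eps) * F <= 0.
      by rewrite mulr_le0_ge0 ?(ltW F0) //; clear -eps1; lra.
    clear -e0 e1 hE0; lra.
  have h4 : (1 - eps) * F <= (1 - eps) * (N ^+ 2 * ((#|T| - 2)`!)%:R).
    by rewrite ler_wpM2l // subr_ge0.
  have h5 : (1 - eps) * ((#|T| - 2)`!)%:R * N ^+ 2 <= #|E|%:R * N ^+ 2.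
    by rewrite ler_pM2r // (le_trans h1).
  clear -h3 h4 h5 hE0; lra.
have hk : 400 * kappa <= h by rewrite hE.
pose Bad := bad_configs c h.
have hBad := card_bad_configs nn kappa_gt0 M_val n2 n3 hk no_full; rewrite -/Bad in hBad.
pose S := perm_class T k :&: E.
have Sk : S \subset perm_class T k by exact: subsetIl.
have h_gt0 : 0 < h by rewrite -hE mulr_gt0.
have Dm_gt0 : 0 < Dm by rewrite DmE; clear -L_ge kappa_gt0; lra.
have hle p i x : (p, (i, x)) \in unfixings k S -> forall l m, l != m ->
  swap_diff c (unfix (p, (i, x))) ((i l, x l), (i m, x m))
    <= h + Dm * ((unfix (p, (i, x)), (i l, i m)) \in Bad)%:R.
  move=> wW l m lm; have [pk ix] := unfixingsP Sk wW.
  have [inji injx _ _ _] := fix_choicesP pk ix.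
  set sg := unfix _.
  (* The point paired with [i r] is its preimage under [sg], which is the form in which
     [bad_configs] describes a configuration. *)
  have inv r : (sg^-1)%g (i r) = x r.
    by apply: (@perm_inj _ sg); rewrite permKV; have [h1 _] := unfix_val pk ix r; exact/esym.
  have u : uniq [:: i l; (sg^-1)%g (i l); i m; (sg^-1)%g (i m)].
    have ne := fix_choices_neq pk ix.
    rewrite !inv /= !inE !negb_or !ne [x l == i m]eq_sym ne.
    by rewrite (inj_eq inji) (inj_eq injx) lm.
  have := config_bound nn kappa_gt0 M_val n2 n3 u hA; rewrite !inv -DmE => hD.
  have [hlt|hle] := ltP h (swap_diff c sg ((i l, x l), (i m, x m))).
    have -> : (sg, (i l, i m)) \in Bad by rewrite in_set u /= !inv.
    by rewrite mulr1; clear -hD h_gt0; lra.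
  by apply: le_trans hle _; rewrite lerDl mulr_ge0 // ltW.
have hS := sum_class_le f_quad Sk (ltW Dm_gt0) hle k_gt0; rewrite -/A -/N in hS.
set v : R := (k`! * _)%:R in hS.
set C : R := #|perm_class T k|%:R.
have hC : F <= 5 * (k`!)%:R * C.
  by rewrite -[5]/(5%:R) -!natrM ler_nat card_perm_class.
have C0 : 0 < C.
  have kf0 : 0 < 5 * (k`!)%:R :> R by rewrite mulr_gt0 // ltr0n fact_gt0.
  by rewrite -(pmulr_rgt0 _ kf0); apply: lt_le_trans F0 hC.
have nT : (0 < #|T|)%N by apply: leq_trans nn.
have hv : N ^+ k * (k`!)%:R <= 2 * v.
  have := exp_le_ffact nT n6; rewrite /v natrM => h1.
  have h2 := ler_wpM2r (ler0n R k`!) h1; clear -h2; lra.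
have v0 : 0 < v.
  have h1 : 0 < N ^+ k * (k`!)%:R by rewrite mulr_gt0 ?exprn_gt0 // ltr0n fact_gt0.
  clear -h1 hv; lra.
have hbad : #|Bad|%:R * N <= 128 * lam * F.
  have h1 := card_heavy_cosets nn hheavy lam_gt0 n9.
  have h2 : #|Bad|%:R <= 8 * (#|heavy_cosets f kappa|%:R * ((#|T| - 1)`!)%:R) :> R.
    by rewrite -[8]/(8%:R) -!natrM ler_nat.
  have h3 : F = N * ((#|T| - 1)`!)%:R.
    by rewrite /F /N -natrM; case: #|T| nT => // j _; rewrite subSS subn0 factS.
  have f0 : 0 <= ((#|T| - 1)`!)%:R :> R by [].
  have h4 : #|heavy_cosets f kappa|%:R * ((#|T| - 1)`!)%:R <= 16 * lam * ((#|T| - 1)`!)%:R.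
    by rewrite ler_wpM2r.
  have h5 : #|Bad|%:R * N <= 8 * (16 * lam * ((#|T| - 1)`!)%:R) * N.
    by rewrite ler_pM2r //; clear -h2 h4; lra.
  by rewrite h3; clear -h5; lra.
have hs : #|S|%:R * N ^+ 2 <= F.
  by apply: le_trans hE1; rewrite ler_pM2r // ler_nat subset_leq_card // subsetIr.
have L0 : 0 <= L by clear -L_ge; lra.
have qN : 0 <= N ^+ k by rewrite exprn_ge0 // ltW.
have hSN : (\sum_(p in S) f p) * N ^+ 2 <= (20 * k%:R * L + 2) * C.
  rewrite natrM in hS.
  by apply: (class_part_arith v0 N0 qN (ler0n R k) L0 (ler0n R 'C(k, 2)) (ltW h_gt0)
     (ltW Dm_gt0) (ltW lam_gt0) (ltW C0) hS hv hA hs hbad hC C2E n7).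
set Y := \sum_(s in perm_class T k) f s.
have hY1 : Y * N ^+ 2 <= alpha * C + (20 * k%:R * L + 2) * C.
  (* Outside [E] the values are below the threshold; only the part in [E] needs the expansion. *)
  have : Y <= alpha / N ^+ 2 * C + \sum_(p in S) f p.
    rewrite /Y (bigID (mem E)) /= addrC; apply: lerD; last first.
      by rewrite le_eqVlt; apply/orP; left; apply/eqP/eq_bigl => s; rewrite in_setI.
    rewrite /C -sum1_card natr_sum mulr_sumr [leRHS](bigID (mem E)) /= ler_wpDl //.
      by apply: sumr_ge0 => s _; rewrite mulr1 divr_ge0 // ltW.
    by apply: ler_sum => s /andP[_]; rewrite in_set -ltNge mulr1 => /ltW.
  rewrite -(ler_pM2r N2) mulrDl => h1.
  have h3 : alpha / N ^+ 2 * C * N ^+ 2 = alpha * C by field; rewrite gt_eqF.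
  clear -h1 h3 hSN; lra.
pose e := A / F.
have he : e * N ^+ 2 <= L by rewrite /e mulrAC ler_pdivrMr.
have e0 : 0 <= e by rewrite divr_ge0 // ltW.
have hsmall : 5 * e + 10 * e * N <= 1 / 2.
  have h1 : e * N <= 1 / 30.
    by rewrite -(ler_pM2r N0); clear -he n1; lra.
  have h2 : e <= e * N by rewrite ler_peMr //; clear -n24; lra.
  clear -h1 h2; lra.
have := class_mean_ge f_quad (leq_trans _ nn) kn f_id hsmall; rewrite -/N -/C -/Y -/A -/F -/e.
move=> /(_ isT) hY2.
have hY3 : C * (k%:R * (k%:R - 1) / 2 - (5 + 10 * k%:R) * L) <= Y * N ^+ 2.
  have := ler_wpM2r (ltW N2) hY2; apply: le_trans.
  have -> : C * (k%:R * (k%:R - 1) / (2 * N ^+ 2) - (5 + 10 * k%:R) * e) * N ^+ 2 =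
     C * (k%:R * (k%:R - 1) / 2 - (5 + 10 * k%:R) * (e * N ^+ 2)).
    by field; rewrite gt_eqF.
  by rewrite ler_pM2l // lerD2l lerN2 ler_wpM2l // addr_ge0 // mulr_ge0.
have hfin : k%:R * (k%:R - 1) / 2 - (5 + 10 * k%:R) * L <= alpha + (20 * k%:R * L + 2).
  by rewrite -(ler_pM2l C0); clear -hY3 hY1; lra.
have kk : k%:R * (80 * L) <= k%:R * (k%:R - 1) :> R.
  by rewrite ler_wpM2l //; clear -k_ge; lra.
have kL : 161 * L <= k%:R * L by rewrite ler_wpM2r.
clear -hfin kk kL LE L_ge; lra.
Qed.

(** All constants are fixed by [alpha], [eps] and [k], before the group and the objective are given.
    [B] adds up the lower bounds on the number of points that they require. *)
Lemma sharp_large_values (R : realFieldType) (alpha eps : R) (k : nat) :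
  0 < alpha -> 0 < eps -> 80 * (2 * (alpha + 1)) + 1 <= k%:R -> exists B : R,
  forall (T : finType) (c : T -> T -> T -> T -> R) (f : {perm T} -> R) (k0 : R),
  (forall s, f s = quad_sum c s + k0) -> \sum_s f s = 0 ->
  (forall s, f s <= 1) -> f 1%g = 1 -> B <= #|T|%:R ->
  (1 - eps) * (#|T|`!)%:R <=
    #|[set s | alpha / #|T|%:R ^+ 2 <= f s]|%:R * #|T|%:R ^+ 2.
Proof.
move=> alpha_gt0 eps_gt0 k_ge.
have [L LE] : exists L, L = 2 * (alpha + 1) by eexists.
rewrite -LE in k_ge; have L_ge : 2 <= L by lra.
have D0 : 0 < 5 * (k`!)%:R * 'C(k, 2)%:R :> R.
  by rewrite !mulr_gt0 ?ltr0n ?fact_gt0 // bin_gt0 -(ler_nat R); lra.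
have [h C2E] : exists h, h * (5 * (k`!)%:R * 'C(k, 2)%:R) = 1 :> R.
  by exists (1 / (5 * (k`!)%:R * 'C(k, 2)%:R)); rewrite divfK ?gt_eqF.
have h_gt0 : 0 < h by rewrite -(pmulr_lgt0 _ D0) C2E.
have [kappa hE] : exists kappa, 400 * kappa = h by exists (h / 400); field.
have kappa_gt0 : 0 < kappa by lra.
have [lam lamE] : exists lam, lam * kappa = L by exists (L / kappa); rewrite divfK ?gt_eqF.
have lam_gt0 : 0 < lam by rewrite -(pmulr_lgt0 _ kappa_gt0) lamE; lra.
have [Dm DmE] : exists Dm, Dm = 16 * (2 * L + 9 * kappa) + 96 * kappa by eexists.
have Dm_gt0 : 0 < Dm by lra.
have [b1 b1E] : exists b1, eps * b1 = 28 * lam + 36.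
  by exists ((28 * lam + 36) / eps); rewrite mulrC divfK ?gt_eqF.
have b1_gt0 : 0 < b1 by rewrite -(pmulr_rgt0 _ eps_gt0) b1E; lra.
have kappa10 : 0 < 10 * kappa by lra.
have [b2 b2E] : exists b2, 10 * kappa * b2 = alpha.
  by exists (alpha / (10 * kappa)); rewrite mulrC divfK ?gt_eqF.
have b2_gt0 : 0 < b2 by rewrite -(pmulr_rgt0 _ kappa10) b2E.
have b3_ge0 : 0 <= 4 * (k%:R : R) ^+ 2 by rewrite mulr_ge0 // sqr_ge0.
have b4_ge0 : 0 <= 1280 * 'C(k, 2)%:R * Dm * lam.
  by apply: mulr_ge0 (ltW lam_gt0); apply: mulr_ge0 (ltW Dm_gt0); apply: mulr_ge0.
exists (24 + 30 * L + 16 * (12 * lam + 18) + 1 + 2 * (28 * lam + 36) + b1 + b2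
  + 4 * (k%:R : R) ^+ 2 + 1280 * 'C(k, 2)%:R * Dm * lam + (k%:R + 3) + (16 * lam + 2)).
move=> T c f k0 f_quad f_sum f_le f_id.
move: b3_ge0 b4_ge0 => b3_ge0 b4_ge0 hB.
apply: (sharp_large_values_aux f_quad f_sum f_le f_id alpha_gt0 eps_gt0 LE k_ge
  kappa_gt0 lam_gt0 lamE hE C2E DmE); try lra.
- by rewrite -b1E ler_pM2l //; lra.
- by rewrite -b2E ler_pM2l //; lra.
Qed.

(** If the large values have density at most [t], the mean of [|f|] is at most [4 * t] and the mean
    over the class of [k] at least [2 * t]. Values below [t] supply at most [t] of it, so a
    proportion [t] of the class is large. *)
Lemma moderate_values (R : realFieldType) (T : finType) (c : T -> T -> T -> T -> R)
    (f : {perm T} -> R) (k0 t : R) (k : nat) :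
  (forall s, f s = quad_sum c s + k0) -> \sum_s f s = 0 ->
  (forall s, f s <= 1) -> f 1%g = 1 -> (4 <= #|T|)%N -> (k + 3 <= #|T|)%N ->
  0 < t -> 120 * t * #|T|%:R <= 1 -> 124 * (#|T|%:R ^+ 2 * t) + 1 <= k%:R ->
  t * (#|T|`!)%:R <= 5 * (k`!)%:R * #|[set s | t <= f s]|%:R.
Proof.
move=> f_quad f_sum f_le f_id n4 kn t0 tN hk.
set E := [set s | _]; set N : R := #|T|%:R in tN hk *.
have F0 : 0 < (#|T|`!)%:R :> R by rewrite ltr0n fact_gt0.
have kf1 : 1 <= (k`!)%:R :> R by rewrite ler1n fact_gt0.
have N4 : 4 <= N by rewrite (ler_nat _ 4).
have [hE|/ltW hE] := leP (#|E|%:R : R) (t * (#|T|`!)%:R); last first.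
  apply: le_trans hE _; rewrite -[X in X <= _]mul1r ler_wpM2r //; lra.
set A := \sum_s `|f s|; pose e := A / (#|T|`!)%:R.
have he : e <= 4 * t.
  rewrite /e ler_pdivrMr //; apply: le_trans (l1_norm_le (ltW t0) f_sum f_le) _.
  by rewrite -/E; lra.
have tt : t <= t * N by rewrite ler_peMr ?(ltW t0) //; lra.
have eN : e * N <= 4 * t * N by rewrite ler_wpM2r //; lra.
have hsmall : 5 * e + 10 * e * N <= 1 / 2 by lra.
have := class_mean_ge f_quad n4 kn f_id hsmall.
rewrite -/A -/e -/N; set C : R := #|perm_class T k|%:R => hY.
have hC : (#|T|`!)%:R <= 5 * (k`!)%:R * C.
  by rewrite -[5]/(5%:R) -!natrM ler_nat card_perm_class.
have C0 : 0 <= C by [].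
have N2 : 0 < N ^+ 2 by rewrite exprn_gt0 //; lra.
(* The quadratic term is at least [62 * k * t] and the error at most [(20 + 40 * k) * t]. *)
have hk0 : 2 * t <= k%:R * (k%:R - 1) / (2 * N ^+ 2) - (5 + 10 * k%:R) * e.
  have k1 : 1 <= (k%:R : R) by have := mulr_gt0 N2 t0; lra.
  have h1 : k%:R * (124 * (N ^+ 2 * t)) <= k%:R * (k%:R - 1) by rewrite ler_wpM2l //; lra.
  have h2 : 62 * k%:R * t <= k%:R * (k%:R - 1) / (2 * N ^+ 2).
    by rewrite ler_pdivlMr ?mulr_gt0 //; lra.
  have h3 : (5 + 10 * k%:R) * e <= (5 + 10 * k%:R) * (4 * t) by rewrite ler_wpM2l //; lra.
  have h4 : t <= k%:R * t by rewrite ler_peMl // ltW.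
  lra.
have h1 : C * (2 * t) <= \sum_(s in perm_class T k) f s.
  by apply: le_trans hY; rewrite ler_wpM2l.
have h2 : \sum_(s in perm_class T k) f s <= t * C + #|E|%:R.
  rewrite /C -!sum1_card !natr_sum mulr_sumr [X in _ <= X + _]big_mkcond [X in _ <= _ + X]big_mkcond.
  rewrite [leLHS]big_mkcond -big_split /=; apply: ler_sum => s _.
  rewrite [s \in E]in_set; case: (s \in perm_class T k); case: (leP t (f s)) => h;
    rewrite ?mulr1 ?addr0 ?add0r ?ler01 ?(ltW h) //.
  by have := f_le s; lra.
have h3 : t * (#|T|`!)%:R <= t * (5 * (k`!)%:R * C) by rewrite ler_wpM2l // ltW.
have h4 : 5 * (k`!)%:R * (C * t) <= 5 * (k`!)%:R * #|E|%:R by rewrite ler_wpM2l //; lra.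
lra.
Qed.

(** * Probabilities *)

From mathcomp Require Import all_classical all_reals all_analysis.

Section Normalization.
Variables (R : realType) (n : nat) (f : 'S_n -> R) (tau : 'S_n).
Hypotheses (f_qap : qap_objective f) (tau_opt : optimal f tau).

Definition large_values (a : R) := [set s : 'S_n | a * centered f tau <= centered f s]%SET.

Lemma sum_centered : \sum_s centered f s = 0.
Proof.
by rewrite /centered sumrB sumr_const card_Sn -[_ *+ n`!]mulr_natl mulrA divff ?mul1r ?subrr //.
Qed.

(** A maximum that is not positive forces the centered objective to vanish, its sum being 0, and
    then every permutation is large. Otherwise one divides by the maximum and translates by [tau],
    which only relabels the values in the coefficients. *)
Lemma normalized_qap :
  (forall a, large_values a = [set: 'S_n]%SET) \/
  exists (c : 'I_n -> 'I_n -> 'I_n -> 'I_n -> R) (k0 : R) (g : 'S_n -> R),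
    [/\ forall s, g s = quad_sum c s + k0, \sum_s g s = 0, forall s, g s <= 1, g 1%g = 1 &
        forall a, #|large_values a| = #|[set s | a <= g s]%SET|].
Proof.
have [M0|M0] := leP (centered f tau) 0.
  left; have fs0 s : centered f s = 0.
    have h s' : 0 <= - centered f s' by rewrite oppr_ge0 (le_trans (tau_opt s')).
    have : \sum_s' - centered f s' == 0 by rewrite sumrN sum_centered oppr0.
    rewrite psumr_eq0 // => /allP/(_ s); rewrite mem_index_enum => /(_ isT) /=.
    by rewrite oppr_eq0 => /eqP.
  by move=> a; apply/setP => s; rewrite !finset.in_set !fs0 mulr0 lexx.
right; set M := centered f tau in M0 *.
have [c cE] : exists c : 'I_n -> 'I_n -> 'I_n -> 'I_n -> R, forall s, f s = quad_sum c s.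
  by case: f_qap => [[A [B fE]]|[c fE]]; [exists (fun i j k l => B k l * A i j) | exists c].
pose k0 := - ((n`!)%:R^-1 * \sum_u f u) / M.
exists (fun i j k l => c i j (tau k) (tau l) / M), k0, (fun s => centered f (s * tau)%g / M).
split.
- move=> s; rewrite /centered /k0 mulrBl mulNr; congr (_ - _).
  rewrite cE /quad_sum mulr_suml; apply: eq_bigr => i _.
  by rewrite mulr_suml; apply: eq_bigr => j _; rewrite !permM.
- rewrite -mulr_suml (_ : \sum_s _ = 0) ?mul0r // -[RHS]sum_centered.
  by rewrite [RHS](reindex_inj (mulIg tau)).
- by move=> s; rewrite ler_pdivrMr // mul1r tau_opt.
- by rewrite mul1g divff // gt_eqF.
move=> a; rewrite -[RHS](card_imset _ (mulIg tau)); apply: eq_card => s.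
rewrite finset.in_set; apply/idP/finset.imsetP => [h|[u + ->]]; last by rewrite finset.in_set ler_pdivlMr.
by exists (s * tau^-1)%g; rewrite ?mulgKV // finset.in_set ler_pdivlMr // mulgKV.
Qed.

End Normalization.

Lemma prob_ge (R : realType) n (E : {set 'S_n}) (x : R) :
  x * (n`!)%:R <= #|E|%:R -> x <= uniform_perm_prob R E.
Proof.
by move=> h; rewrite /uniform_perm_prob card_Sn ler_pdivlMr // ltr0n fact_gt0.
Qed.

Lemma prob_setT (R : realType) n : uniform_perm_prob R [set: 'S_n]%SET = 1.
Proof.
by rewrite /uniform_perm_prob cardsT divff // card_Sn pnatr_eq0 -lt0n fact_gt0.
Qed.

Lemma exists_nat_ge (R : realType) (x : R) : exists N : nat, forall n, (N <= n)%N -> x <= n%:R.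
Proof.
exists (Num.truncn x).+1 => n; rewrite -(ler_nat R); apply: le_trans.
exact/ltW/truncnS_gt.
Qed.

Lemma sharp_prob (R : realType) (alpha eps : R) : 0 < alpha -> 0 < eps < 1 ->
  exists N : nat, forall n, (N <= n)%N ->
  forall (f : 'S_n -> R) (tau : 'S_n), qap_objective f -> optimal f tau ->
    (1 - eps) * n%:R ^- 2 <= uniform_perm_prob R (large_values f tau (alpha / n%:R ^+ 2)).
Proof.
move=> alpha0 /andP[eps0 eps1].
have [k hk] := exists_nat_ge (80 * (2 * (alpha + 1)) + 1).
have [B hB] := sharp_large_values alpha0 eps0 (hk _ (leqnn k)).
have [N hN] := exists_nat_ge B; exists (maxn N 1) => n; rewrite geq_max => /andP[Nn n0].
have n1 : 1 <= (n%:R : R) by rewrite ler1n.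
have n2 : 1 <= (n%:R : R) ^+ 2 by rewrite exprn_ege1.
have n2' : 0 < (n%:R : R) ^+ 2 by lra.
move=> f tau fq ftau; case: (normalized_qap fq ftau) => [->|[c [k0 [g [gq gs gl g1 gE]]]]].
  rewrite prob_setT ler_pdivrMr // mul1r; lra.
apply: prob_ge; rewrite gE mulrAC ler_pdivrMr //.
by have := hB _ c g k0 gq gs gl g1; rewrite card_ord; apply; apply: hN.
Qed.

Lemma exists_nat_powR_ge (R : realType) (s K : R) : 0 < s ->
  exists N : nat, forall n, (N <= n)%N -> K <= (n%:R : R) `^ s.
Proof.
move=> s0; have [N hN] := exists_nat_ge (`|K| `^ s^-1); exists N => n /hN h.
apply: le_trans (ler_norm K) _.
have -> : `|K| = (`|K| `^ s^-1) `^ s by rewrite -powRrM mulVf ?gt_eqF // powRr1.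
by rewrite ge0_ler_powR ?nnegrE ?powR_ge0 // ltW.
Qed.

Lemma fact_le_exp k n : (k <= n)%N -> (k`! <= n ^ k)%N.
Proof.
rewrite -ffactnn => kn; apply: leq_trans (ffact_le_exp k k) _; case: k kn => // k kn.
by rewrite leq_exp2r.
Qed.

(** [moderate_values] gives probability at least [t / (5 * k!)] with [k] of order [n ^ (1 - eps)]
    when [eps < 1]. As [k!] is at most [exp (k * ln n)], any exponent above [1 - eps] absorbs the
    logarithm and the constants. *)
Lemma moderate_prob (R : realType) (eps delta : R) :
  0 < eps -> 1 - eps < delta -> 0 < delta ->
  exists N : nat, forall n, (N <= n)%N ->
  forall (f : 'S_n -> R) (tau : 'S_n), qap_objective f -> optimal f tau ->
    expR (- (n%:R `^ delta)) <=
      uniform_perm_prob R (large_values f tau (n%:R `^ (- 1 - eps))).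
Proof.
move=> eps0 delta_gt delta0.
(* For [eps > 1] the quantity [N ^ (1 - eps)] drops below 1, while [k] remains at least 1; [N ^ mu]
   dominates in both cases. *)
pose mu := Num.max 0 (1 - eps).
have mu0 : 0 <= mu by rewrite le_max lexx.
have mu_eps : 1 - eps <= mu by rewrite le_max lexx orbT.
have mu1 : 0 < 1 - mu by rewrite subr_gt0 gt_max ltr01 /=; lra.
have mud : mu < delta by rewrite gt_max delta0.
(* The gap between [mu] and [delta] is halved: one factor [N ^ s] absorbs [ln N], the other the
   constants. *)
pose s := (delta - mu) / 2; have s0 : 0 < s by rewrite divr_gt0 // subr_gt0.
have [N1 hN1] := exists_nat_powR_ge 130 mu1.
have [N2 hN2] := exists_nat_powR_ge 120 eps0.
have [N3 hN3] := exists_nat_powR_ge ((140 + eps) / s) s0.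
have [N5 hN5] := exists_nat_ge (expR 1 : R).
exists (maxn (maxn N1 N2) (maxn N3 (maxn 4 N5))) => n.
rewrite !geq_max => /andP[/andP[/hN1 h1 /hN2 h2] /and3P[/hN3 h3 n4 /hN5 h5]].
have N4 : 4 <= (n%:R : R) by rewrite (ler_nat _ 4).
set N : R := n%:R in h1 h2 h3 h5 N4 *.
have N0 : 0 < N by lra.
have Nn0 : N != 0 by rewrite gt_eqF.
have pD x y : N `^ (x + y) = N `^ x * N `^ y by rewrite powRD // Nn0 implybT.
move=> f tau fq ftau; case: (normalized_qap fq ftau) => [->|[c [k0 [g [gq gs gl g1 gE]]]]].
  by rewrite prob_setT expR_le1 oppr_le0 powR_ge0.
set t := N `^ (- 1 - eps); have t0 : 0 < t by rewrite powR_gt0.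
pose w := N `^ (1 - eps); have w0 : 0 < w by rewrite powR_gt0.
have wE : N ^+ 2 * t = w.
  by rewrite -powR_mulrn ?ltW // -pD; congr (_ `^ _); ring.
have w_le : w <= N `^ mu by apply: ler_powR; lra.
have mu_ge1 : 1 <= N `^ mu by rewrite -(powRr0 N); apply: ler_powR; lra.
have mu_le : 130 * N `^ mu <= N.
  have NmE : N = N `^ (1 - mu) * N `^ mu by rewrite -pD subrK powRr1 // ltW.
  rewrite [leRHS]NmE.
  by rewrite ler_wpM2r // powR_ge0.
pose k := (Num.truncn (124 * w + 1)).+1.
have k_gt : 124 * w + 1 < k%:R := truncnS_gt _.
have k_le : (k%:R : R) <= 124 * w + 2.
  have kE : (k%:R : R) = (Num.truncn (124 * w + 1))%:R + 1 by rewrite natr1.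
  rewrite kE; have : ((Num.truncn (124 * w + 1))%:R : R) <= 124 * w + 1.
    by rewrite truncn_le; lra.
  lra.
have kn : (k + 3 <= n)%N by rewrite -(ler_nat R) natrD -/N; lra.
have tN : 120 * t * N <= 1.
  have tNE : t * N = (N `^ eps)^-1.
    by rewrite -powRN -[X in _ * X](powRr1 (ltW N0)) -pD; congr (_ `^ _); ring.
  rewrite -mulrA tNE ler_pdivrMr ?mul1r //; lra.
have hk : 124 * (N ^+ 2 * t) + 1 <= k%:R by rewrite wE ltW.
have := @moderate_values R 'I_n c g k0 t k gq gs gl g1; rewrite !card_ord -/N.
move=> /(_ n4 kn t0 tN hk) hE.
apply: prob_ge; rewrite gE.
have F0 : 0 < (n`!)%:R :> R by rewrite ltr0n fact_gt0.
have kf0 : 0 < 5 * (k`!)%:R :> R by rewrite mulr_gt0 // ltr0n fact_gt0.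
rewrite -(ler_pM2l kf0); apply: le_trans hE; rewrite mulrA ler_pM2r //.
have NE : N = expR (ln N) by rewrite lnK // posrE.
have lnN1 : 1 <= ln N by rewrite -ler_expR -NE.
have kexp : (k`!)%:R <= expR (k%:R * ln N).
  rewrite expRM_natl -NE -natrX ler_nat; apply: fact_le_exp.
  exact: leq_trans (leq_addr 3 k) kn.
have tE : t = expR ((- 1 - eps) * ln N) by rewrite /t /powR gt_eqF.
have five : 5 <= expR (4 : R) by have := expR_ge1Dx (4 : R); lra.
have hexp : 4 + k%:R * ln N + (1 + eps) * ln N <= N `^ delta.
  have lnNs : ln N <= N `^ s / s.
    rewrite ler_pdivlMr // mulrC -ln_powR ltW //.
    by apply: ln_sublinear; rewrite powR_gt0.
  have dE : N `^ delta = N `^ mu * N `^ s * N `^ s.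
    by rewrite -!pD; congr (_ `^ _); rewrite /s; field.
  have q1 : 4 + k%:R * ln N + (1 + eps) * ln N <= (k%:R + 5 + eps) * ln N by lra.
  have q2 : k%:R + 5 + eps <= (140 + eps) * N `^ mu.
    have : eps <= eps * N `^ mu by rewrite ler_peMr // ltW.
    lra.
  have q3 : (k%:R + 5 + eps) * ln N <= (140 + eps) * N `^ mu * (N `^ s / s).
    by rewrite ler_pM //; [rewrite !addr_ge0 // ltW | lra].
  have q4 : (140 + eps) / s * (N `^ mu * N `^ s) <= N `^ s * (N `^ mu * N `^ s).
    by rewrite ler_wpM2r // mulr_ge0 // powR_ge0.
  apply: le_trans q1 _; apply: le_trans q3 _; rewrite dE.
  apply: le_trans (_ : _ <= N `^ s * (N `^ mu * N `^ s)) _; last by rewrite mulrC.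
  by apply: le_trans q4; rewrite le_eqVlt; apply/orP; left; apply/eqP; field; rewrite gt_eqF.
have kf : 5 * (k`!)%:R <= expR (4 + k%:R * ln N).
  by rewrite expRD ler_pM.
apply: (@le_trans _ _ (expR (4 + k%:R * ln N) * expR (- N `^ delta))).
  by rewrite ler_wpM2r // expR_ge0.
by rewrite -expRD tE ler_expR; lra.
Qed.

Theorem corollary5p2 (R : realType) :
  ((forall alpha : R, 1 < alpha ->
      exists delta : R, 0 < delta /\
      exists N : nat, forall n : nat, (4 <= n)%N -> (N <= n)%N ->
      forall (f : 'S_n -> R) (tau : 'S_n), qap_objective f -> optimal f tau ->
        delta * n%:R ^- 2 <=
        uniform_perm_prob R
          [set s : 'S_n |
            alpha / n%:R ^+ 2 * centered f tau <= centered f s]%SET) /\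
   (exists c : R, 0 < c /\
      forall alpha : R, 1 < alpha ->
      exists N : nat, forall n : nat, (4 <= n)%N -> (N <= n)%N ->
      forall (f : 'S_n -> R) (tau : 'S_n), qap_objective f -> optimal f tau ->
        expR (- (c * alpha * ln alpha)) * n%:R ^- 2 <=
        uniform_perm_prob R
          [set s : 'S_n |
            alpha / n%:R ^+ 2 * centered f tau <= centered f s]%SET)) /\
  ((forall eps : R, 0 < eps ->
      exists delta : R, delta < 1 /\
      exists N : nat, forall n : nat, (4 <= n)%N -> (N <= n)%N ->
      forall (f : 'S_n -> R) (tau : 'S_n), qap_objective f -> optimal f tau ->
        expR (- (n%:R `^ delta)) <=
        uniform_perm_prob R
          [set s : 'S_n |
            n%:R `^ (- 1 - eps) * centered f tau <= centered f s]%SET) /\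
   (forall eps : R, 0 < eps ->
      forall delta : R, 1 - eps < delta -> 0 < delta ->
      exists N : nat, forall n : nat, (4 <= n)%N -> (N <= n)%N ->
      forall (f : 'S_n -> R) (tau : 'S_n), qap_objective f -> optimal f tau ->
        expR (- (n%:R `^ delta)) <=
        uniform_perm_prob R
          [set s : 'S_n |
            n%:R `^ (- 1 - eps) * centered f tau <= centered f s]%SET)).
Proof.
(* Every constant below 1 in front of [n ^ -2] is available, and [exp (- alpha * ln alpha)] is below
   1 for [alpha > 1]. Hence [c = 1] will do. *)
have sharp (alpha : R) : 1 < alpha ->
    exists N : nat, forall n : nat, (4 <= n)%N -> (N <= n)%N ->
    forall (f : 'S_n -> R) (tau : 'S_n), qap_objective f -> optimal f tau ->
      expR (- (1 * alpha * ln alpha)) * n%:R ^- 2 <=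
      uniform_perm_prob R
        [set s : 'S_n | alpha / n%:R ^+ 2 * centered f tau <= centered f s]%SET.
  move=> a1; have a0 : 0 < alpha by lra.
  have x0 : 0 < alpha * ln alpha by rewrite mulr_gt0 // ln_gt0.
  have [|N hN] := @sharp_prob R alpha (1 - expR (- (1 * alpha * ln alpha))) a0.
    rewrite subr_gt0 mul1r expR_lt1 oppr_lt0 x0 ltrBlDr ltrDl.
    exact: expR_gt0.
  by exists N => n _ /hN h f tau fq ftau; have := h f tau fq ftau; rewrite subKr.
have moderate (eps delta : R) : 0 < eps -> 1 - eps < delta -> 0 < delta ->
    exists N : nat, forall n : nat, (4 <= n)%N -> (N <= n)%N ->
    forall (f : 'S_n -> R) (tau : 'S_n), qap_objective f -> optimal f tau ->
      expR (- (n%:R `^ delta)) <=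
      uniform_perm_prob R
        [set s : 'S_n | n%:R `^ (- 1 - eps) * centered f tau <= centered f s]%SET.
  move=> e0 d1 d0; have [N hN] := moderate_prob e0 d1 d0.
  by exists N => n _ /hN; apply.
split; split.
- move=> alpha a1; exists (expR (- (1 * alpha * ln alpha))); split; first exact: expR_gt0.
  exact: sharp.
- by exists 1; split.
(* The term [1 - eps / 2] puts the exponent above [1 - eps], and [1 / 2] keeps it positive for large
   [eps]. *)
- move=> eps e0; exists (Num.max (1 / 2) (1 - eps / 2)); split.
    by rewrite gt_max; apply/andP; split; lra.
  by apply: moderate => //; rewrite lt_max; apply/orP; [right | left]; lra.
- by move=> eps e0 delta d1 d0; apply: moderate.
Qed.
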